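(* Fix $M>0$ and $0<\theta_1<\theta_2<2s-1$. There exists a constant $c_2>0$ such that if $$\limsup_{n\to\infty}\sup_{\theta\in[\theta_1,\theta_2]}\Big\{\Delta_n(\theta)\Big(\frac{n}{\sqrt{\log\log n}}\Big)^{\frac{4s}{4s+\theta+1}}\Big\}\le c_2,$$ then $$\lim_{n\to\infty}\inf_{T\in\mathcal T_n}\Big[\mathbb E_{P_0}T+\sup_{\theta\in[\theta_1,\theta_2]}\beta(T;\Delta_n(\theta),\theta,M)\Big]=1,$$ where $\mathcal T_n$ is the collection of all measurable test functions $T:\mathcal X^n\to[0,1]$ of $X_1,\dots,X_n$.
   Context: Standing setup. $(\mathcal X,\mathcal B)$ is a measurable space and $P_0$ a known probability measure on it. $K$ is a symmetric, positive semidefinite, square-integrable kernel, degenerate under $P_0$, with Mercer decomposition $K(x,x')=\sum_{k\ge1}\lambda_k\varphi_k(x)\varphi_k(x')$, infinitely many eigenvalues $\lambda_1>\lambda_2>\cdots>0$, $\{\varphi_k\}$ an orthonormal basis of the $P_0$-mean-zero functions in $L_2(P_0)$, $0<\liminf_k k^{2s}\lambda_k\le\limsup_k k^{2s}\lambda_k<\infty$ for some $s>1/2$, and $\sup_k\|\varphi_k\|_\infty<\infty$. $\mathcal H(K)$ is the RKHS of $K$, $\|f\|_K^2=\sum_k\lambda_k^{-1}\langle f,\varphi_k\rangle_{L_2(P_0)}^2$. $\mathcal F(\theta;M)$ ($\theta>0$) is the set of $f\in L_2(P_0)$ such that for every $R>0$ there is $f_R\in\mathcal H(K)$ with $\|f_R\|_K\le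 R$ and $\|f-f_R\|_{L_2(P_0)}\le MR^{-1/\theta}$. $\mathcal P(\Delta,\theta,M)$ is the set of probability measures $P\ll P_0$ with $u=dP/dP_0-1\in\mathcal F(\theta;M)$ and $\|u\|^2_{L_2(P_0)}\ge\Delta$. Type II error: $\beta(T;\Delta,\theta,M)=\sup_{P\in\mathcal P(\Delta,\theta,M)}\mathbb E_P[1-T(X_1,\dots,X_n)]$ with $X_i$ i.i.d. $P$; $\mathbb E_{P_0}T$ is the type I error. *)

(* Defs.v *)
From HB Require Import structures.
From mathcomp Require Import all_boot all_order all_algebra.
From mathcomp Require Import all_classical all_reals all_analysis.
Set Implicit Arguments. Unset Strict Implicit. Unset Printing Implicit Defensive.
Import Order.TTheory GRing.Theory Num.Theory.
Import numFieldNormedType.Exports.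
Local Open Scope classical_set_scope.
Local Open Scope ring_scope.

Definition L2fun d (X : measurableType d) (R : realType)
    (mu : {measure set X -> \bar R}) (f : X -> R) : Prop :=
  measurable_fun setT f /\ finite_norm mu 2%:E f.

Definition L2norm d (X : measurableType d) (R : realType)
    (mu : {measure set X -> \bar R}) (f : X -> R) : \bar R :=
  'N[mu]_(2%:E)[EFin \o f]%E.

Definition L2inner d (X : measurableType d) (R : realType)
    (mu : {measure set X -> \bar R}) (f g : X -> R) : R :=
  Rintegral mu setT (fun x => f x * g x).

(** RKHS squared norm ||f||_K^2 = sum_k lam_k^{-1} <f, phi_k>^2
    (the eigenpair (lam_k, phi_k) of the paper, k >= 1, is stored at index k-1). *)
Definition rkhs_norm2 d (X : measurableType d) (R : realType)
    (mu : {measure set X -> \bar R}) (lam : nat -> R) (phi : nat -> X -> R)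
    (f : X -> R) : \bar R :=
  (\sum_(0 <= k <oo) (((lam k)^-1 * (L2inner mu f (phi k)) ^+ 2)%:E))%E.

(** membership in H(K): a P0-mean-zero L_2 function with finite RKHS norm
    (H(K) is the closed span of the phi_k with the norm above). *)
Definition in_RKHS d (X : measurableType d) (R : realType)
    (mu : {measure set X -> \bar R}) (lam : nat -> R) (phi : nat -> X -> R)
    (f : X -> R) : Prop :=
  L2fun mu f /\ Rintegral mu setT f = 0 /\ (rkhs_norm2 mu lam phi f < +oo)%E.

Definition Fclass d (X : measurableType d) (R : realType)
    (mu : {measure set X -> \bar R}) (lam : nat -> R) (phi : nat -> X -> R)
    (theta M : R) (f : X -> R) : Prop :=
  L2fun mu f /\
  forall Rad : R, 0 < Rad ->
    exists fR : X -> R, in_RKHS mu lam phi fR /\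
      (rkhs_norm2 mu lam phi fR <= (Rad ^+ 2)%:E)%E /\
      (L2norm mu (fun x => f x - fR x)%R <= (M * Rad `^ (- theta^-1))%:E)%E.

Definition Pclass d (X : measurableType d) (R : realType)
    (mu : {measure set X -> \bar R}) (lam : nat -> R) (phi : nat -> X -> R)
    (Delta theta M : R) : set (probability X R) :=
  [set P | exists u : X -> R,
     measurable_fun setT u /\
     (forall A : set X, measurable A -> P A = (\int[mu]_(x in A) (1 + u x)%:E)%E) /\
     Fclass mu lam phi theta M u /\
     (Delta%:E <= L2norm mu u * L2norm mu u)%E].

(** E[g(X_1,...,X_n)] for X_1,...,X_n i.i.d. with law P, g >= 0 measurable on
    X^n, written as the iterated integral against the n-fold product of P
    (Tonelli). X_1 is the head of the tuple. *)
Fixpoint iidE d (X : measurableType d) (R : realType)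
    (P : {measure set X -> \bar R}) (n : nat) : (n.-tuple X -> \bar R) -> \bar R :=
  match n return (n.-tuple X -> \bar R) -> \bar R with
  | 0 => fun g => g [tuple]
  | m.+1 => fun g => (\int[P]_x iidE P (fun t : m.-tuple X => g (cons_tuple x t)))%E
  end.

Definition tests d (X : measurableType d) (R : realType) (n : nat)
  : set (n.-tuple X -> R) :=
  [set T : n.-tuple X -> R | measurable_fun setT T /\ forall t, 0 <= T t <= 1].

Definition typeII d (X : measurableType d) (R : realType)
    (mu : {measure set X -> \bar R}) (lam : nat -> R) (phi : nat -> X -> R)
    (n : nat) (T : n.-tuple X -> R) (Delta theta M : R) : \bar R :=
  ereal_sup [set iidE P (fun t => (1 - T t)%:E) | P in Pclass mu lam phi Delta theta M].

Definition minimax_risk d (X : measurableType d) (R : realType)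
    (mu : probability X R) (lam : nat -> R) (phi : nat -> X -> R)
    (n : nat) (Delta : R -> R) (th1 th2 M : R) : \bar R :=
  ereal_inf [set (iidE mu (fun t => (T t)%:E) +
                 ereal_sup [set typeII mu lam phi T (Delta th) th M
                           | th in [set th : R | (th1 <= th <= th2)%R]])%E
            | T in @tests d X R n].

(* Main.v *)
(** Le Cam's method with a two-level prior.  Put [t = n / sqrt (ln (ln n))] and
    [e th = 2 (th + 1) / (4 s + th + 1)], so that the critical radius at
    smoothness [th] is [sqrt N / t] with [N = t ^ (e th)].  Each dyadic block
    [2^j <= k < 2^(j+1)] with [t ^ (e th1) <= 2^j <= t ^ (e th2)] is matched
    with the [th_j] such that [2^j = t ^ (e th_j)], and carries the densities
    [1 + a_j * sum_(k in block j) (+-1) phi_k] with uniform random signs.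
    Inside a block, the likelihood ratio has second moment at most
    [exp (2 (n a_j^2)^2 2^j)], which is at most [sqrt (ln n)] for a small
    constant; distinct blocks are orthogonal and contribute exactly 1.
    Averaging over the [~ ln n] blocks makes the second moment of the mixture
    likelihood ratio tend to 1.  The condition [th2 < 2 s - 1] means
    [e th2 < 2/3], which is what keeps the densities nonnegative. *)
Require Import Defs.
From HB Require Import structures.
From mathcomp Require Import all_boot all_order all_algebra.
From mathcomp Require Import all_classical all_reals all_analysis.
From mathcomp Require Import measurable_realfun zify ring lra.
Import Order.TTheory GRing.Theory Num.Theory.
Import numFieldNormedType.Exports.
Local Open Scope classical_set_scope.
Local Open Scope ring_scope.
Set Implicit Arguments. Unset Strict Implicit. Unset Printing Implicit Defensive.

(** * Integration against a density and under i.i.d. sampling *)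

Lemma exists_probability_density (d : measure_display) (X : measurableType d)
    (R : realType) (mu : probability X R) (f : X -> R) :
  measurable_fun setT f -> (forall x, 0 <= f x) ->
  (\int[mu]_x (f x)%:E = 1)%E ->
  exists P : probability X R,
    forall A, measurable A -> P A = (\int[mu]_(x in A) (f x)%:E)%E.
Proof.
move=> mf f0 f1.
have intf : mu.-integrable setT (EFin \o f).
  apply/integrableP; split; first exact/measurable_EFinP.
  under eq_integral => x _ do rewrite /= ger0_norm//.
  by rewrite f1 ltry.
pose m (A : set X) : \bar R := (\int[mu]_(x in A) (f x)%:E)%E.
have m0 : m set0 = 0%E by rewrite /m integral_set0.
have mge0 A : (0 <= m A)%E by apply: integral_ge0 => x _; rewrite lee_fin.
have madd : semi_sigma_additive m.
  move=> A mA tA mUA; rewrite /m integral_bigcup//; last first.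
    exact: (integrableS _ _ (@subsetT _ _)).
  apply: is_cvg_ereal_nneg_natsum_cond => n _ _; exact: mge0.
pose M := isMeasure.Build _ _ _ m m0 mge0 madd.
have [mm mmE] : exists mm : {measure set X -> \bar R}, forall A, mm A = m A.
  by exists (HB.pack_for {measure set X -> \bar R} m M).
have mm1 : mm setT = 1%E by rewrite mmE.
(* [mnormalize] supplies the probability structure and does not change [mm], whose mass is already
   1; [mu] is its fallback for mass 0 or infinity. *)
exists (mnormalize mm mu) => A _.
by rewrite /= /mnormalize/= mm1 eqe oner_eq0 /= invr1 mule1 mmE.
Qed.

(** Change of variables is available for the Radon-Nikodym derivative of [P]; [f] has the same
    integral over every measurable set, hence agrees with it [mu]-almost everywhere. *)
Lemma ge0_integral_density (d : measure_display) (X : measurableType d)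
    (R : realType) (mu P : probability X R) (f : X -> R) (g : X -> \bar R) :
  measurable_fun setT f -> (forall x, 0 <= f x) ->
  (forall A, measurable A -> P A = (\int[mu]_(x in A) (f x)%:E)%E) ->
  measurable_fun setT g -> (forall x, 0 <= g x)%E ->
  (\int[P]_x g x = \int[mu]_x (g x * (f x)%:E))%E.
Proof.
move=> mf f0 Pf mg g0.
have intf : mu.-integrable setT (EFin \o f).
  apply/integrableP; split; first exact/measurable_EFinP.
  under eq_integral => x _ do rewrite /= ger0_norm//.
  by rewrite -Pf// probability_setT ltry.
have dom : P `<< mu.
  apply/null_content_dominatesP => A mA A0; rewrite Pf//.
  by apply: null_set_integral => //; apply/measurable_EFinP/measurable_funTS.
rewrite -(Radon_Nikodym_SigmaFinite.change_of_variables dom)//.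
have mRN := measurable_int _ (Radon_Nikodym_SigmaFinite.f_integrable dom).
apply: ae_eq_integral => //.
- exact: emeasurable_funM.
- by apply: emeasurable_funM => //; exact/measurable_EFinP.
- have : ae_eq mu setT (Radon_Nikodym_SigmaFinite.f P mu) (EFin \o f).
    apply: integral_ae_eq => //.
    + exact: Radon_Nikodym_SigmaFinite.f_integrable.
    + exact/measurable_EFinP.
    + move=> E _ mE; apply: etrans (Pf E mE).
      exact/esym/(Radon_Nikodym_SigmaFinite.f_integral dom).
  by apply: filterS => x h /h /= ->.
Qed.

Section iidE_theory.
Context (d : measure_display) (X : measurableType d) (R : realType).
Variable P : probability X R.
Local Open Scope ereal_scope.

Lemma iidE_ge0 n (g : n.-tuple X -> \bar R) :
  (forall t, 0 <= g t) -> 0 <= iidE P g.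
Proof.
elim: n g => [|n IH] g g0 /=; first exact: g0.
by apply: integral_ge0 => x _; exact: IH.
Qed.

(** The parameter space [Y] is arbitrary so that the induction can absorb the first observation into
    it, passing from [Y] to [Y * X]; each step is then one application of Tonelli. *)
Lemma measurable_iidE n (d' : measure_display) (Y : measurableType d')
    (g : Y * n.-tuple X -> \bar R) :
  measurable_fun setT g -> (forall z, 0 <= g z) ->
  measurable_fun setT (fun y => iidE P (fun t => g (y, t))).
Proof.
elim: n d' Y g => [|n IH] d' Y g mg g0 /=.
  by apply: measurableT_comp => //; exact: measurable_fun_pair.
pose g' (z : (Y * X) * n.-tuple X) := g (z.1.1, cons_tuple z.1.2 z.2).
have mg' : measurable_fun setT g'.
  apply: measurableT_comp => //; apply: measurable_fun_pair => /=.
    by apply: measurableT_comp => //; exact: measurable_fst.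
  apply: measurable_cons => //.
  by apply: measurableT_comp => //; exact: measurable_snd.
have g'0 z : 0 <= g' z by exact: g0.
have := measurable_fun_fubini_tonelli_F (m2 := P)
  (fun z : Y * X => iidE P (fun t => g' (z, t))).
apply; first exact: IH.
by move=> z; exact: iidE_ge0.
Qed.

Lemma measurable_cons_tuple n (x : X) :
  measurable_fun setT (fun t : n.-tuple X => cons_tuple x t).
Proof. by apply: measurable_cons => //; exact: measurable_id. Qed.

Lemma measurable_iidE_cons n (g : n.+1.-tuple X -> \bar R) :
  measurable_fun setT g -> (forall t, 0 <= g t) ->
  measurable_fun setT (fun x => iidE P (fun t => g (cons_tuple x t))).
Proof.
move=> mg g0.
apply: (measurable_iidE (g := fun z : X * n.-tuple X => g (cons_tuple z.1 z.2))) => //.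
by apply: measurableT_comp => //; exact: measurable_cons.
Qed.

Lemma eq_iidE n (f g : n.-tuple X -> \bar R) : f =1 g -> iidE P f = iidE P g.
Proof. by move=> /funext ->. Qed.

Lemma le_iidE n (f g : n.-tuple X -> \bar R) :
  measurable_fun setT f -> measurable_fun setT g ->
  (forall t, 0 <= f t) -> (forall t, f t <= g t) -> iidE P f <= iidE P g.
Proof.
elim: n f g => [|n IH] f g mf mg f0 fg /=; first exact: fg.
have g0 t : 0 <= g t by exact: le_trans (f0 t) (fg t).
apply: ge0_le_integral => //.
- by move=> x _; exact: iidE_ge0.
- exact: measurable_iidE_cons.
- exact: measurable_iidE_cons.
- move=> x _; apply: IH => //.
  + exact: (measurableT_comp mf (measurable_cons_tuple x)).
  + exact: (measurableT_comp mg (measurable_cons_tuple x)).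
Qed.

Lemma iidED n (f g : n.-tuple X -> \bar R) :
  measurable_fun setT f -> measurable_fun setT g ->
  (forall t, 0 <= f t) -> (forall t, 0 <= g t) ->
  iidE P (fun t => f t + g t) = iidE P f + iidE P g.
Proof.
elim: n f g => [|n IH] f g mf mg f0 g0 //=.
rewrite -ge0_integralD//.
- apply: eq_integral => x _; apply: IH => //.
  + exact: (measurableT_comp mf (measurable_cons_tuple x)).
  + exact: (measurableT_comp mg (measurable_cons_tuple x)).
- by move=> x _; exact: iidE_ge0.
- exact: measurable_iidE_cons.
- by move=> x _; exact: iidE_ge0.
- exact: measurable_iidE_cons.
Qed.

Lemma iidEZl n (k : R) (g : n.-tuple X -> \bar R) : (0 <= k)%R ->
  measurable_fun setT g -> (forall t, 0 <= g t) ->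
  iidE P (fun t => k%:E * g t) = k%:E * iidE P g.
Proof.
move=> k0; elim: n g => [|n IH] g mg g0 //=.
rewrite -ge0_integralZl_EFin//.
- apply: eq_integral => x _; apply: IH => //.
  exact: (measurableT_comp mg (measurable_cons_tuple x)).
- by move=> x _; exact: iidE_ge0.
- exact: measurable_iidE_cons.
Qed.

Lemma iidE_cst n (k : R) : (0 <= k)%R -> iidE P (fun _ : n.-tuple X => k%:E) = k%:E.
Proof.
move=> k0; elim: n => [|n IH] //=; under eq_integral do rewrite IH.
by rewrite integral_cst// [X in _ * X]probability_setT mule1.
Qed.

Lemma iidE_sum n (I : Type) (r : seq I) (g : I -> n.-tuple X -> \bar R) :
  (forall i, measurable_fun setT (g i)) -> (forall i t, 0 <= g i t) ->
  iidE P (fun t => \sum_(i <- r) g i t) = \sum_(i <- r) iidE P (g i).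
Proof.
move=> mg g0; elim: r => [|i r IH].
  by under eq_iidE do rewrite big_nil; rewrite iidE_cst// big_nil.
under eq_iidE do rewrite big_cons.
rewrite iidED//; first by rewrite IH big_cons.
- exact: emeasurable_sum.
- by move=> t; apply: sume_ge0 => j _; exact: g0.
Qed.

Lemma measurable_prod_tuple n (f : X -> R) : measurable_fun setT f ->
  measurable_fun setT (fun t : n.-tuple X => \prod_(i < n) f (tnth t i))%R.
Proof.
move=> mf; apply: measurable_prod => i _.
by apply: measurableT_comp => //; exact: measurable_tnth.
Qed.

Lemma prod_cons_tuple n (f : X -> R) (x : X) (t : n.-tuple X) :
  (\prod_(i < n.+1) f (tnth (cons_tuple x t) i) =
   f x * \prod_(i < n) f (tnth t i))%R.
Proof.
by rewrite big_ord_recl tnth0; congr (_ * _)%R; apply: eq_bigr => i _; rewrite tnthS.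
Qed.

Lemma iidE_prod n (f : X -> R) (k : R) : measurable_fun setT f ->
  (forall x, 0 <= f x)%R -> \int[P]_x (f x)%:E = k%:E ->
  iidE P (fun t : n.-tuple X => (\prod_(i < n) f (tnth t i))%:E) = (k ^+ n)%:E.
Proof.
move=> mf f0 fk.
have k0 : (0 <= k)%R.
  by rewrite -lee_fin -fk; apply: integral_ge0 => x _; rewrite lee_fin.
elim: n => [|n IH] /=; first by rewrite big_ord0 expr0.
rewrite (@eq_integral _ _ _ _ _ (fun x => (k ^+ n)%:E * (f x)%:E)); last first.
  move=> x _; under eq_iidE do rewrite prod_cons_tuple EFinM.
  rewrite iidEZl//; first by rewrite IH muleC.
  + by apply/measurable_EFinP; exact: measurable_prod_tuple.
  + by move=> t; rewrite lee_fin; apply: prodr_ge0.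
rewrite ge0_integralZl_EFin//; first by rewrite fk -EFinM exprSr.
- by move=> x _; rewrite lee_fin.
- exact/measurable_EFinP.
- exact: exprn_ge0.
Qed.

End iidE_theory.

(** The likelihood ratio of an i.i.d. sample is the product of the one-observation densities.
    Coordinates are exchanged one at a time, [f x] being constant for the inner expectation. *)
Lemma iidE_density (d : measure_display) (X : measurableType d)
    (R : realType) (mu P : probability X R) (f : X -> R) n
    (g : n.-tuple X -> \bar R) :
  measurable_fun setT f -> (forall x, 0 <= f x) ->
  (forall A, measurable A -> P A = (\int[mu]_(x in A) (f x)%:E)%E) ->
  measurable_fun setT g -> (forall t, 0 <= g t)%E ->
  iidE P g = iidE mu (fun t => ((\prod_(i < n) f (tnth t i))%:E * g t)%E).
Proof.
move=> mf f0 Pf; elim: n g => [|n IH] g mg g0 /=.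
  by rewrite big_ord0 mul1e.
rewrite (ge0_integral_density mf f0 Pf); last 2 first.
- exact: measurable_iidE_cons.
- by move=> x; exact: iidE_ge0.
have mgx x : measurable_fun setT (fun t => g (cons_tuple x t)).
  exact: (measurableT_comp mg (measurable_cons_tuple x)).
apply: eq_integral => x _; rewrite IH// muleC -iidEZl//.
- by apply: eq_iidE => t; rewrite prod_cons_tuple EFinM muleA.
- apply: emeasurable_funM => //.
  by apply/measurable_EFinP; exact: measurable_prod_tuple.
- by move=> t; rewrite mule_ge0// lee_fin; apply: prodr_ge0.
Qed.

(** * Second moment lower bound on the testing risk *)

(** This is [T + L (1 - T) = 1 - (1 - L) (1 - T)] combined with Young's inequality of weight [eta].
    It is arranged without subtracting [L], so that for [L >= 0] both sides integrate as nonnegative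
    functions. *)
Lemma test_likelihood_ineq (R : realFieldType) (eta T L : R) :
  0 < eta -> 0 <= T <= 1 ->
  1 + eta^-1 * L <=
  T + L * (1 - T) + (2 * eta)^-1 * (L * L) + ((2 * eta)^-1 + eta / 2).
Proof.
move=> eta0 /andP[T0 T1]; rewrite -subr_ge0.
suff -> : T + L * (1 - T) + (2 * eta)^-1 * (L * L) + ((2 * eta)^-1 + eta / 2)
    - (1 + eta^-1 * L) =
    (2 * eta)^-1 * (((1 - L) - (1 - T) * eta) ^+ 2 + eta ^+ 2 * (T * (2 - T))).
  apply: mulr_ge0; first by rewrite invr_ge0 mulr_ge0// ltW.
  by rewrite addr_ge0 ?sqr_ge0// mulr_ge0 ?sqr_ge0// mulr_ge0// subr_ge0; lra.
by field; rewrite gt_eqF.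
Qed.

Section second_moment_bound.
Context (d : measure_display) (X : measurableType d) (R : realType).
Variables (P0 : probability X R) (n : nat) (I : finType).
Variables (f : I -> X -> R) (P : I -> probability X R) (g : I -> I -> R).
Hypothesis I0 : (0 < #|I|)%N.
Hypothesis mf : forall i, measurable_fun setT (f i).
Hypothesis f0 : forall i x, 0 <= f i x.
Hypothesis Pf : forall i A, measurable A ->
  P i A = (\int[P0]_(x in A) (f i x)%:E)%E.
Hypothesis fg : forall i j, (\int[P0]_x (f i x * f j x)%:E = (g i j)%:E)%E.

Let w : R := #|I|%:R^-1.
Let F i (t : n.-tuple X) := \prod_(k < n) f i (tnth t k).
Let L t := \sum_i w * F i t.

Let w0 : 0 <= w. Proof. by rewrite invr_ge0. Qed.

Let F0 i t : 0 <= F i t. Proof. exact: prodr_ge0. Qed.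

Let mF i : measurable_fun setT (F i).
Proof. exact: measurable_prod_tuple. Qed.

Let mwF i : measurable_fun setT (fun t => w * F i t).
Proof. exact: measurable_funM. Qed.

Let L0 t : 0 <= L t.
Proof. by apply: sumr_ge0 => i _; rewrite mulr_ge0. Qed.

Let mL : measurable_fun setT L. Proof. exact: measurable_sum. Qed.

Let iidE_L : iidE P0 (fun t => (L t)%:E) = 1%E.
Proof.
under eq_iidE do rewrite -sumEFin.
rewrite iidE_sum; last 2 first.
- by move=> i; exact/measurable_EFinP.
- by move=> i t; rewrite lee_fin mulr_ge0.
have fi1 i : (\int[P0]_x (f i x)%:E = 1%:E)%E by rewrite -Pf// probability_setT.
under eq_bigr => i _.
  under eq_iidE do rewrite EFinM.
  rewrite iidEZl//; last 2 first.
  - by apply/measurable_EFinP.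
  - by move=> t; rewrite lee_fin.
  rewrite (iidE_prod n (mf i) (f0 i) (fi1 i)) expr1n mule1.
  over.
by rewrite sumEFin sumr_const -mulr_natr mulVf// pnatr_eq0 -lt0n.
Qed.

(** Expanding the square leaves the products [F i * F j], each of which factors over independent
    observations with one-observation mean [g i j]. *)
Let iidE_L2 :
  iidE P0 (fun t => (L t * L t)%:E) = (w ^+ 2 * \sum_i \sum_j g i j ^+ n)%:E.
Proof.
have LL t : (L t * L t)%:E =
    (\sum_(i : I) \sum_(j : I) (w ^+ 2 * (F i t * F j t))%:E)%E.
  rewrite /L big_distrl /= -sumEFin; apply: eq_bigr => i _.
  rewrite big_distrr /= -sumEFin; apply: eq_bigr => j _.
  by congr EFin; ring.
under eq_iidE do rewrite LL.
have mij i j : measurable_fun setT (fun t => (w ^+ 2 * (F i t * F j t))%:E).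
  by apply/measurable_EFinP; apply: measurable_funM => //; exact: measurable_funM.
have ij0 i j t : (0 <= (w ^+ 2 * (F i t * F j t))%:E)%E.
  by rewrite lee_fin mulr_ge0 ?exprn_ge0// mulr_ge0.
rewrite iidE_sum; last 2 first.
- by move=> i; exact: emeasurable_sum.
- by move=> i t; exact: sume_ge0.
rewrite mulr_sumr -sumEFin; apply: eq_bigr => i _.
rewrite iidE_sum// mulr_sumr -sumEFin; apply: eq_bigr => j _.
under eq_iidE do rewrite EFinM.
rewrite iidEZl ?exprn_ge0//; last 2 first.
- by apply/measurable_EFinP; exact: measurable_funM.
- by move=> t; rewrite lee_fin mulr_ge0.
rewrite [RHS]EFinM; congr (_ * _)%E.
rewrite -(iidE_prod n _ _ (fg i j)).
- by apply: eq_iidE => t; rewrite -big_split.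
- exact: measurable_funM.
- by move=> x; rewrite mulr_ge0.
Qed.

(** Since [L] has mean 1 under [P0], the excess of its second moment over 1 is its variance. The
    free [eta] is to be balanced against that variance. *)
Lemma test_risk_ge (T : n.-tuple X -> R) (eta : R) : tests T -> 0 < eta ->
  ((1 - (w ^+ 2 * (\sum_i \sum_j g i j ^+ n) - 1) / (2 * eta) - eta / 2)%:E <=
   iidE P0 (fun t => (T t)%:E) +
   \sum_i w%:E * iidE (P i) (fun t => (1 - T t)%:E))%E.
Proof.
move=> [mT T01] eta0.
have T0 t : 0 <= T t by have /andP[] := T01 t.
have T1 t : 0 <= 1 - T t by rewrite subr_ge0; have /andP[] := T01 t.
have mT1 : measurable_fun setT (fun t => 1 - T t) by exact: measurable_funB.
(* Changing measure in each summand turns the averaged type II error into a single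
   [P0]-expectation. *)
have -> : (\sum_i w%:E * iidE (P i) (fun t => (1 - T t)%:E) =
    iidE P0 (fun t => (L t * (1 - T t))%:E))%E.
  under [RHS]eq_iidE do rewrite mulr_suml -sumEFin.
  rewrite iidE_sum; last 2 first.
  - by move=> i; apply/measurable_EFinP; exact: measurable_funM.
  - by move=> i t; rewrite lee_fin mulr_ge0// mulr_ge0.
  apply: eq_bigr => i _.
  rewrite (iidE_density (mf i) (f0 i) (Pf i)); last 2 first.
  - exact/measurable_EFinP.
  - by move=> t; rewrite lee_fin.
  rewrite -iidEZl//.
  - by apply: eq_iidE => t; rewrite -!EFinM mulrA.
  - by apply: emeasurable_funM; apply/measurable_EFinP => //; exact: mF.
  - by move=> t; rewrite -EFinM lee_fin mulr_ge0 ?F0.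
have h : (iidE P0 (fun t => (1 + eta^-1 * L t)%:E) <=
    iidE P0 (fun t => (T t + L t * (1 - T t) + (2 * eta)^-1 * (L t * L t)
      + ((2 * eta)^-1 + eta / 2))%:E))%E.
  apply: le_iidE.
  - by apply/measurable_EFinP; apply: measurable_funD => //; exact: measurable_funM.
  - apply/measurable_EFinP; apply: measurable_funD => //.
    apply: measurable_funD; first apply: measurable_funD => //.
      exact: measurable_funM.
    by apply: measurable_funM => //; exact: measurable_funM.
  - by move=> t; rewrite lee_fin addr_ge0// mulr_ge0// invr_ge0 ltW.
  - by move=> t; rewrite lee_fin; exact: test_likelihood_ineq.
have e0 : 0 <= eta^-1 by rewrite invr_ge0 ltW.
have e20 : 0 <= (2 * eta)^-1 by rewrite invr_ge0 mulr_ge0// ltW.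
have k0 : 0 <= (2 * eta)^-1 + eta / 2 by rewrite addr_ge0// divr_ge0// ltW.
have mTL : measurable_fun setT (fun t => L t * (1 - T t)) by exact: measurable_funM.
have mLL : measurable_fun setT (fun t => L t * L t) by exact: measurable_funM.
have mkLL : measurable_fun setT (fun t => (2 * eta)^-1 * (L t * L t)).
  exact: measurable_funM.
have mkL : measurable_fun setT (fun t => eta^-1 * L t) by exact: measurable_funM.
have mS : measurable_fun setT (fun t => T t + L t * (1 - T t)).
  exact: measurable_funD.
have mS' : measurable_fun setT
    (fun t => T t + L t * (1 - T t) + (2 * eta)^-1 * (L t * L t)).
  exact: measurable_funD.
have S0 t : 0 <= T t + L t * (1 - T t) by rewrite addr_ge0// mulr_ge0.
have kLL0 t : 0 <= (2 * eta)^-1 * (L t * L t) by rewrite mulr_ge0// mulr_ge0.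
have iidEDr (a b : n.-tuple X -> R) : measurable_fun setT a ->
    measurable_fun setT b -> (forall t, 0 <= a t) -> (forall t, 0 <= b t) ->
    iidE P0 (fun t => (a t + b t)%:E) =
    (iidE P0 (fun t => (a t)%:E) + iidE P0 (fun t => (b t)%:E))%E.
  move=> ma mb a0 b0; rewrite -iidED//.
  - exact/measurable_EFinP.
  - exact/measurable_EFinP.
have iidEZr (k : R) (a : n.-tuple X -> R) : 0 <= k -> measurable_fun setT a ->
    (forall t, 0 <= a t) ->
    iidE P0 (fun t => (k * a t)%:E) = (k%:E * iidE P0 (fun t => (a t)%:E))%E.
  move=> k1 ma a0; rewrite -iidEZl//.
  exact/measurable_EFinP.
have kL0 t : 0 <= eta^-1 * L t by rewrite mulr_ge0.
have LT0 t : 0 <= L t * (1 - T t) by rewrite mulr_ge0.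
have LL0 t : 0 <= L t * L t by rewrite mulr_ge0.
have SL0 t : 0 <= T t + L t * (1 - T t) + (2 * eta)^-1 * (L t * L t).
  by rewrite addr_ge0.
rewrite -iidEDr//; move: h; rewrite [in X in (X <= _)%E -> _]iidEDr//.
rewrite (iidE_cst _ _ ler01) [in X in (X <= _)%E -> _]iidEZr// iidE_L mule1.
rewrite (iidEDr _ _ mS')// (iidEDr _ _ mS)// iidEZr//.
rewrite iidE_L2 iidE_cst// -addeA -EFinM -!EFinD -leeBlDr// -EFinB.
apply: le_trans; rewrite lee_fin le_eqVlt; apply/orP; left; apply/eqP.
by field; rewrite gt_eqF.
Qed.

End second_moment_bound.

(** * Moments of random signs *)

(** Near 0, [expR y <= (1 - y)^-1] bounds the sum by [2 / (1 - y ^+ 2)], which is at most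
    [2 (1 + 2 y ^+ 2)] when [y ^+ 2 <= 1 / 2]. Larger arguments are reduced by halving. *)
Lemma cosh_le_expR_sqr (R : realType) (x : R) :
  expR x + expR (- x) <= 2 * expR (2 * x ^+ 2).
Proof.
have small (y : R) : y ^+ 2 <= 1 / 2 -> expR y + expR (- y) <= 2 * expR (2 * y ^+ 2).
  move=> y2; have [y1 y1'] : 0 < 1 - y /\ 0 < 1 + y by split; nra.
  have e1 : expR y <= (1 - y)^-1.
    rewrite -[expR y]invrK -expRN lef_pV2 ?posrE ?expR_gt0//.
    exact: expR_ge1Dx.
  have e2 : expR (- y) <= (1 + y)^-1.
    by rewrite expRN lef_pV2 ?posrE ?expR_gt0//; exact: expR_ge1Dx.
  apply: le_trans (lerD e1 e2) _.
  apply: (@le_trans _ _ (2 * (1 + 2 * y ^+ 2))); last first.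
    by rewrite ler_pM2l//; exact: expR_ge1Dx.
  have -> : (1 - y)^-1 + (1 + y)^-1 = 2 / ((1 - y) * (1 + y)).
    by field; rewrite !gt_eqF.
  rewrite ler_pdivrMr ?mulr_gt0//.
  have := sqr_ge0 y; nra.
(* The induction is on the number [m] of halvings that bring [x] into the range of [small]. *)
have [m] : exists m : nat, `|x| <= 2 ^+ m / 2.
  exists (Num.trunc (2 * `|x|)).+1; rewrite ler_pdivlMr// mulrC.
  have : 2 * `|x| < (Num.trunc (2 * `|x|)).+1%:R by exact: truncnS_gt.
  move/ltW/le_trans; apply.
  by rewrite -natrX ler_nat; apply/ltnW; exact: ltn_expl.
elim: m x => [|m IH] x hx.
  apply: small; rewrite -(real_normK (num_real x)).
  by move: hx (normr_ge0 x); rewrite expr0; nra.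
have hy : `|x / 2| <= 2 ^+ m / 2.
  rewrite normrM (ger0_norm (_ : 0 <= 2^-1))//.
  by rewrite ler_pM2r//; move: hx; rewrite exprS; lra.
have := IH _ hy.
have -> : expR x = expR (x / 2) ^+ 2 by rewrite -expRM_natl; congr expR; field.
have -> : expR (- x) = expR (- (x / 2)) ^+ 2.
  by rewrite -expRM_natl; congr expR; field.
have -> : expR (2 * x ^+ 2) = expR (2 * (x / 2) ^+ 2) ^+ 4.
  by rewrite -expRM_natl; congr expR; field.
have p1 : expR (x / 2) * expR (- (x / 2)) = 1 by rewrite -expRD subrr expR0.
have := expR_gt0 (x / 2); have := expR_gt0 (- (x / 2)).
have := expR_gt0 (2 * (x / 2) ^+ 2).
move: (expR _) (expR _) (expR _) p1 => e b a ab e0 b0 a0 h.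
have h2 : (a + b) ^+ 2 <= (2 * e) ^+ 2.
  by apply: lerXn2r => //; rewrite nnegrE ltW// ?addr_gt0 ?mulr_gt0.
have -> : a ^+ 2 + b ^+ 2 = (a + b) ^+ 2 - 2 by rewrite sqrrD ab; ring.
(* This square says that [4 e ^+ 2 - 2 <= 2 e ^+ 4], which closes the doubling step. *)
have : 0 <= 2 * (e ^+ 2 - 1) ^+ 2 by rewrite mulr_ge0// sqr_ge0.
move: h2; rewrite sqrrB exprMn -!exprM /=; lra.
Qed.

(** The exponential is a product over coordinates, so the sum over sign vectors factors: a cosh
    bound for each coordinate in [S], a factor 2 for each other one. The fixed signs [e'] disappear
    by symmetry. *)
Lemma sum_sign_expR_le (R : realType) (K : nat) (S : {pred 'I_K}) (y : R)
    (e' : {ffun 'I_K -> bool}) :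
  \sum_(e : {ffun 'I_K -> bool})
     expR (y * \sum_(k | S k) (-1) ^+ e k * (-1) ^+ e' k) <=
  2 ^+ K * expR (2 * y ^+ 2 * #|S|%:R).
Proof.
pose h (k : 'I_K) (b : bool) : R :=
  if S k then expR (y * ((-1) ^+ b * (-1) ^+ e' k)) else 1.
have -> : \sum_(e : {ffun 'I_K -> bool})
     expR (y * \sum_(k | S k) (-1) ^+ e k * (-1) ^+ e' k) =
    \sum_(e : {ffun 'I_K -> bool}) \prod_k h k (e k).
  apply: eq_bigr => e _; rewrite mulr_sumr expR_sum big_mkcond /=.
  by apply: eq_bigr => k _; rewrite /h; case: ifP.
rewrite -bigA_distr_bigA /=.
apply: (@le_trans _ _ (\prod_(k < K) (2 * if S k then expR (2 * y ^+ 2) else 1))).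
  apply: ler_prod => k _; apply/andP; split.
    by apply: sumr_ge0 => b _; rewrite /h; case: ifP => // _; exact: expR_ge0.
  rewrite big_bool /h; case: ifP => _; last by rewrite mulr1.
  case: (e' k); rewrite /= expr1 expr0 ?mulr1 ?mulrN1 ?opprK ?mul1r ?mulrN ?mulr1.
    exact: cosh_le_expR_sqr.
  by rewrite addrC; exact: cosh_le_expR_sqr.
rewrite big_split /= prodr_const card_ord ler_pM2l ?exprn_gt0//.
by rewrite -big_mkcond /= prodr_const expRM_natr.
Qed.

(** The inequality [1 + z <= expR z], raised to the power [n] thanks to [0 <= 1 + z], reduces the
    moment to the exponential sum with [n%:R * y] in place of [y]. *)
Lemma sum_sign_moment_le (R : realType) (K n : nat) (S : {pred 'I_K}) (y : R) :
  (forall e e' : {ffun 'I_K -> bool},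
     0 <= 1 + y * \sum_(k | S k) (-1) ^+ e k * (-1) ^+ e' k) ->
  \sum_(e : {ffun 'I_K -> bool}) \sum_(e' : {ffun 'I_K -> bool})
    (1 + y * \sum_(k | S k) (-1) ^+ e k * (-1) ^+ e' k) ^+ n <=
  2 ^+ K * 2 ^+ K * expR (2 * (n%:R * y) ^+ 2 * #|S|%:R).
Proof.
move=> ge0; rewrite exchange_big /=.
apply: (@le_trans _ _ (\sum_(e' : {ffun 'I_K -> bool})
    2 ^+ K * expR (2 * (n%:R * y) ^+ 2 * #|S|%:R))).
  apply: ler_sum => e' _; apply: le_trans (sum_sign_expR_le _ _ e').
  apply: ler_sum => e _; rewrite -mulrA expRM_natl lerXn2r ?nnegrE ?expR_ge0//.
  exact: expR_ge1Dx.
by rewrite sumr_const card_ffun card_ord card_bool -[leLHS]mulr_natr natrX mulrAC.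
Qed.

(** * Bounded combinations of the eigenfunctions *)

Section bounded_functions.
Context (d : measure_display) (X : measurableType d) (R : realType).
Variable mu : probability X R.

(** The bound is pointwise, not almost sure, so that densities built from such functions can be made
    nonnegative everywhere. *)
Definition bounded_mfun (f : X -> R) :=
  measurable_fun setT f /\ exists C, forall x, `|f x| <= C.

Lemma bounded_mfun_integrable f : bounded_mfun f -> mu.-integrable setT (EFin \o f).
Proof.
move=> [mf [C fC]]; apply: measurable_bounded_integrable => //.
  by rewrite [X in (X < _)%E]probability_setT ltry.
exists C; split; first exact: num_real.
by move=> M CM x _; apply: le_trans (fC x) (ltW CM).
Qed.

Lemma bounded_mfun_cst c : bounded_mfun (fun=> c).
Proof. by split; [exact: measurable_cst|exists `|c|]. Qed.

Lemma bounded_mfunD f g :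
  bounded_mfun f -> bounded_mfun g -> bounded_mfun (fun x => f x + g x).
Proof.
move=> [mf [A fA]] [mg [B gB]]; split; first exact: measurable_funD.
by exists (A + B) => x; apply: le_trans (ler_normD _ _) (lerD _ _).
Qed.

Lemma bounded_mfunM f g :
  bounded_mfun f -> bounded_mfun g -> bounded_mfun (fun x => f x * g x).
Proof.
move=> [mf [A fA]] [mg [B gB]]; split; first exact: measurable_funM.
by exists (A * B) => x; rewrite normrM; exact: ler_pM.
Qed.

Lemma bounded_mfun_sum (I : Type) (r : seq I) (f : I -> X -> R) :
  (forall i, bounded_mfun (f i)) -> bounded_mfun (fun x => \sum_(i <- r) f i x).
Proof.
move=> bf; elim: r => [|i r IH].
  by under eq_fun do rewrite big_nil; exact: bounded_mfun_cst.
by under eq_fun do rewrite big_cons; exact: bounded_mfunD.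
Qed.

Lemma bounded_Rintegral_sum (I : Type) (r : seq I) (f : I -> X -> R) :
  (forall i, bounded_mfun (f i)) ->
  Rintegral mu setT (fun x => \sum_(i <- r) f i x) =
  \sum_(i <- r) Rintegral mu setT (f i).
Proof.
move=> bf; elim: r => [|i r IH].
  under [in LHS]eq_fun do rewrite big_nil.
  by rewrite big_nil Rintegral_cst// mul0r.
under [in LHS]eq_fun do rewrite big_cons.
rewrite big_cons -IH RintegralD//; apply: bounded_mfun_integrable => //.
exact: bounded_mfun_sum.
Qed.

Lemma EFin_bounded_Rintegral f : bounded_mfun f ->
  (Rintegral mu setT f)%:E = (\int[mu]_x (f x)%:E)%E.
Proof.
move=> /bounded_mfun_integrable fi; rewrite fineK//.
exact: integrable_fin_num.
Qed.

Lemma L2norm_bounded f : bounded_mfun f ->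
  L2norm mu f = (Num.sqrt (Rintegral mu setT (fun x => f x ^+ 2)))%:E.
Proof.
move=> bf; rewrite /L2norm unlock /=.
under eq_integral => x _.
  rewrite /= (powR_mulrn 2)// real_normK ?num_real//.
  over.
rewrite -EFin_bounded_Rintegral; last exact: bounded_mfunM.
rewrite poweR_EFin powR12_sqrt//.
by apply: Rintegral_ge0 => x _; exact: sqr_ge0.
Qed.

Lemma bounded_L2fun f : bounded_mfun f -> L2fun mu f.
Proof.
move=> bf; split; first by case: bf.
by rewrite /finite_norm -/(L2norm mu f) L2norm_bounded// ltry.
Qed.

End bounded_functions.

Lemma eq_ae_L2inner (d : measure_display) (X : measurableType d) (R : realType)
    (mu : probability X R) (f g g' : X -> R) :
  measurable_fun setT f -> measurable_fun setT g -> measurable_fun setT g' ->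
  ae_eq mu setT g g' -> L2inner mu f g = L2inner mu f g'.
Proof.
move=> mf mg mg' gg'; congr fine; apply: ae_eq_integral => //.
- by apply/measurable_EFinP; exact: measurable_funM.
- by apply/measurable_EFinP; exact: measurable_funM.
- by apply: filterS gg' => x /= h /h ->.
Qed.

Section combinations.
Context (d : measure_display) (X : measurableType d) (R : realType).
Variables (mu : probability X R) (phi psi : nat -> X -> R).
Hypothesis mphi : forall k, measurable_fun setT (phi k).
Hypothesis bpsi : forall k, bounded_mfun (psi k).
Hypothesis phi_psi : forall k, ae_eq mu setT (phi k) (psi k).
Hypothesis phi_mean : forall k, Rintegral mu setT (phi k) = 0.
Hypothesis phi_on : forall j k, L2inner mu (phi j) (phi k) = (j == k)%:R.

Let mpsi k : measurable_fun setT (psi k). Proof. by case: (bpsi k). Qed.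

(** The combination is built on [psi], an everywhere bounded version of [phi]; its coefficients are
    still read off against [phi], as [rkhs_norm2] requires. *)
Definition comb K (b : nat -> R) (x : X) := \sum_(k < K) b k * psi k x.

Let bterm (b : nat -> R) k : bounded_mfun (fun x => b k * psi k x).
Proof. by apply: bounded_mfunM => //; exact: bounded_mfun_cst. Qed.

Lemma bounded_comb K b : bounded_mfun (comb K b).
Proof. exact: bounded_mfun_sum. Qed.

Let psi_mean k : Rintegral mu setT (psi k) = 0.
Proof.
rewrite -(phi_mean k); congr fine; apply/esym; apply: ae_eq_integral => //.
- exact/measurable_EFinP.
- exact/measurable_EFinP.
- by apply: filterS (phi_psi k) => x /= h /h ->.
Qed.

Let psi_on j k : L2inner mu (psi j) (phi k) = (j == k)%:R.
Proof.
rewrite -phi_on.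
have sw f g : L2inner mu f g = L2inner mu g f.
  by rewrite /L2inner; under eq_fun do rewrite mulrC.
by rewrite sw [RHS]sw; apply/esym/eq_ae_L2inner.
Qed.

Lemma comb_mean K b : Rintegral mu setT (comb K b) = 0.
Proof.
rewrite bounded_Rintegral_sum//; apply: big1 => k _.
by rewrite RintegralZl// ?psi_mean ?mulr0//; exact: bounded_mfun_integrable.
Qed.

(** [phi k] is replaced by [psi k] to keep the integrands bounded, then restored termwise to apply
    orthonormality. *)
Lemma comb_inner K b k :
  L2inner mu (comb K b) (phi k) = if (k < K)%N then b k else 0.
Proof.
rewrite (eq_ae_L2inner _ _ _ (phi_psi k))//; last by case: (bounded_comb K b).
rewrite /L2inner /comb; under eq_fun do rewrite mulr_suml.
rewrite bounded_Rintegral_sum; last first.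
  by move=> i; exact: bounded_mfunM.
under eq_bigr => i _.
  under eq_fun do rewrite -mulrA.
  rewrite RintegralZl//; last first.
    by apply: bounded_mfun_integrable; exact: bounded_mfunM.
  rewrite -/(L2inner mu (psi i) (psi k)) -(eq_ae_L2inner _ _ _ (phi_psi k))//.
  rewrite psi_on.
  over.
case: ltnP => kK.
  rewrite (bigD1 (Ordinal kK))//= eqxx mulr1 big1 ?addr0// => i ik.
  by rewrite (_ : (i == k :> nat) = false) ?mulr0//; apply: negbTE.
apply: big1 => i _; rewrite (_ : (i == k :> nat) = false) ?mulr0//.
by apply: negbTE; rewrite neq_ltn (leq_trans (ltn_ord i) kK).
Qed.

Lemma comb_comb K b b' :
  Rintegral mu setT (fun x => comb K b x * comb K b' x) = \sum_(k < K) b k * b' k.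
Proof.
under eq_fun do rewrite {2}/comb mulr_sumr.
rewrite bounded_Rintegral_sum; last first.
  by move=> i; apply: bounded_mfunM => //; exact: bounded_comb.
apply: eq_bigr => k _.
under eq_fun do rewrite mulrCA.
rewrite RintegralZl//; last first.
  by apply: bounded_mfun_integrable; apply: bounded_mfunM => //; exact: bounded_comb.
rewrite -/(L2inner mu (comb K b) (psi k)) -(eq_ae_L2inner _ _ _ (phi_psi k))//; last first.
  by case: (bounded_comb K b).
by rewrite comb_inner ltn_ord mulrC.
Qed.

Lemma integral_1Dcomb K b :
  (\int[mu]_x (1 + comb K b x)%:E = 1)%E.
Proof.
have b1 := bounded_mfun_cst X 1.
rewrite -EFin_bounded_Rintegral; last first.
  by apply: bounded_mfunD => //; exact: bounded_comb.
rewrite RintegralD//; try exact: bounded_mfun_integrable.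
- by rewrite comb_mean addr0 Rintegral_cst// mul1r [X in fine X]probability_setT.
- by apply: bounded_mfun_integrable; exact: bounded_comb.
Qed.

(** The linear terms have mean zero, which leaves the inner product of the coefficients. These
    integrals become the entries [g] of the second moment bound. *)
Lemma integral_1Dcomb_1Dcomb K b b' :
  (\int[mu]_x ((1 + comb K b x) * (1 + comb K b' x))%:E =
   (1 + \sum_(k < K) b k * b' k)%:E)%E.
Proof.
have b1 := bounded_mfun_cst X 1.
have bc := bounded_comb K b; have bc' := bounded_comb K b'.
have b1c : bounded_mfun (fun x => 1 + comb K b x) by exact: bounded_mfunD.
have b1c' : bounded_mfun (fun x => 1 + comb K b' x) by exact: bounded_mfunD.
have bcc : bounded_mfun (fun x => comb K b x * comb K b' x) by exact: bounded_mfunM.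
rewrite -EFin_bounded_Rintegral; last exact: bounded_mfunM.
have -> : (fun x => (1 + comb K b x) * (1 + comb K b' x)) =
    (fun x => (1 + comb K b x) + (comb K b' x + comb K b x * comb K b' x)).
  by apply/funext => x; ring.
rewrite RintegralD//; try apply: bounded_mfun_integrable => //; last exact: bounded_mfunD.
rewrite [X in _ + X]RintegralD//; try exact: bounded_mfun_integrable.
rewrite comb_mean add0r comb_comb; congr (_ + _)%:E.
by apply: EFin_inj; rewrite EFin_bounded_Rintegral// integral_1Dcomb.
Qed.

Variable lam : nat -> R.
Hypothesis lam_gt0 : forall k, 0 < lam k.

Lemma rkhs_norm2_comb_le K (b : nat -> R) W :
  \sum_(k < K) (lam k)^-1 * b k ^+ 2 <= W ->
  (rkhs_norm2 mu lam phi (comb K b) <= W%:E)%E.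
Proof.
move=> bW; apply: lime_le.
  by apply: is_cvg_nneseries => k _ _; rewrite lee_fin mulr_ge0 ?sqr_ge0// invr_ge0 ltW.
apply: nearW => m; rewrite sumEFin lee_fin; apply: le_trans bW.
have t0 k : 0 <= (lam k)^-1 * b k ^+ 2 by rewrite mulr_ge0 ?sqr_ge0// invr_ge0 ltW.
(* Both finite sums are written as masked sums over [maxn m K] terms and compared termwise;
   coefficients from [K] on vanish. *)
rewrite -(big_mkord xpredT (fun k => (lam k)^-1 * b k ^+ 2)).
rewrite [leRHS](@big_nat_widen _ _ _ 0%N K (maxn m K)) ?leq_maxr//=.
rewrite [leLHS](@big_nat_widen _ _ _ 0%N m (maxn m K)) ?leq_maxl//=.
rewrite big_mkcond [leRHS]big_mkcond /=; apply: ler_sum => k _.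
rewrite comb_inner; case: (k < m)%N; case: (k < K)%N => //.
by rewrite expr0n /= mulr0.
Qed.

(** Two approximants suffice. If [W <= Rad ^+ 2], the function itself is used, with error 0.
    Otherwise 0 is used: the error is the whole norm, and [Rad < Num.sqrt W] makes the last
    hypothesis strong enough to bound it. *)
Lemma comb_Fclass K (b : nat -> R) W theta M : 0 < theta -> 0 < W ->
  \sum_(k < K) (lam k)^-1 * b k ^+ 2 <= W ->
  Num.sqrt (\sum_(k < K) b k ^+ 2) * (Num.sqrt W) `^ (theta^-1) <= M ->
  Fclass mu lam phi theta M (comb K b).
Proof.
move=> th0 W0 bW QM; have bc := bounded_comb K b.
split; first exact: bounded_L2fun.
move=> Rad Rad0.
have sW0 : 0 < Num.sqrt W by rewrite sqrtr_gt0.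
have ex0 : bounded_mfun (fun _ : X => 0 : R) by exact: bounded_mfun_cst.
have M0 : 0 <= M by apply: le_trans QM; rewrite mulr_ge0// powR_ge0.
have nrm : L2norm mu (comb K b) = (Num.sqrt (\sum_(k < K) b k ^+ 2))%:E.
  by rewrite L2norm_bounded//; congr (Num.sqrt _)%:E; exact: comb_comb.
have n0 : L2norm mu (fun _ : X => 0 : R) = 0%E.
  rewrite L2norm_bounded//; under eq_fun do rewrite expr0n.
  by rewrite Rintegral_cst// mul0r sqrtr0.
have [WR|RW] := leP W (Rad ^+ 2).
  exists (comb K b); split; last split.
  - split; first exact: bounded_L2fun.
    split; first exact: comb_mean.
    by apply: le_lt_trans (rkhs_norm2_comb_le bW) _; rewrite ltry.
  - by apply: le_trans (rkhs_norm2_comb_le bW) _; rewrite lee_fin.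
  - under [X in L2norm mu X]eq_fun do rewrite subrr.
    by rewrite n0 lee_fin mulr_ge0// powR_ge0.
have z : comb 0 b = (fun _ : X => 0 : R).
  by apply/funext => x; rewrite /comb big_ord0.
have r0 : (rkhs_norm2 mu lam phi (fun _ : X => 0%R) <= 0%:E)%E.
  by rewrite -z; apply: rkhs_norm2_comb_le; rewrite big_ord0.
exists (fun=> 0); split; last split.
- split; first exact: bounded_L2fun.
  split; first by rewrite Rintegral_cst// mul0r.
  by apply: le_lt_trans r0 _; rewrite ltry.
- by apply: le_trans r0 _; rewrite lee_fin sqr_ge0.
- under [X in L2norm mu X]eq_fun do rewrite subr0.
  rewrite nrm lee_fin powRN ler_pdivlMr ?powR_gt0//.
  apply: le_trans QM; apply: ler_wpM2l => //.
  apply: ge0_ler_powR; rewrite ?nnegrE ?invr_ge0 ?ltW//.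
  by rewrite -(@ltr_pXn2r _ 2)// ?nnegrE ?ltW// sqr_sqrtr// ltW.
Qed.

Lemma comb_Pclass K (b : nat -> R) W theta M Delta (P : probability X R) :
  0 < theta -> 0 < W ->
  \sum_(k < K) (lam k)^-1 * b k ^+ 2 <= W ->
  Num.sqrt (\sum_(k < K) b k ^+ 2) * (Num.sqrt W) `^ (theta^-1) <= M ->
  Delta <= \sum_(k < K) b k ^+ 2 ->
  (forall A, measurable A -> P A = (\int[mu]_(x in A) (1 + comb K b x)%:E)%E) ->
  Pclass mu lam phi Delta theta M P.
Proof.
move=> th0 W0 bW QM DQ PA; have bc := bounded_comb K b.
exists (comb K b); split; first by case: bc.
split; first exact: PA.
split; first exact: (comb_Fclass th0 W0 bW QM).
rewrite L2norm_bounded// -EFinM lee_fin -expr2 sqr_sqrtr.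
  by apply: le_trans DQ _; rewrite le_eqVlt; apply/orP; left; apply/eqP/esym; exact: comb_comb.
by apply: Rintegral_ge0 => x _; exact: sqr_ge0.
Qed.

End combinations.

(** * The mixture over blocks and signs *)

Lemma ge_weighted_sume (R : realType) (I : finType) (v : I -> \bar R) (S : \bar R) :
  (0 < #|I|)%N -> (forall i, 0 <= v i)%E -> (forall i, v i <= S)%E ->
  (\sum_i (#|I|%:R^-1)%:E * v i <= S)%E.
Proof.
move=> I0 v0 vS; have w0 : 0 <= #|I|%:R^-1 :> R by rewrite invr_ge0.
have [i _] := card_gt0P I0.
case: S vS => [r| |] vS; [|by rewrite leey|]; last first.
  by have := le_trans (v0 i) (vS i).
apply: (@le_trans _ _ (\sum_(j : I) (#|I|%:R^-1 * r)%:E)%E).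
  by apply: lee_sum => j _; rewrite EFinM; apply: lee_wpmul2l; rewrite ?lee_fin.
by rewrite sumEFin lee_fin sumr_const -[leLHS]mulr_natl mulrA mulfV ?mul1r// pnatr_eq0 -lt0n.
Qed.

(** An average risk is at most the worst-case risk. Each member of the prior may sit at its own
    smoothness [th i], because the supremum also runs over [th]. *)
Lemma average_le_minimax_risk (d : measure_display) (X : measurableType d)
    (R : realType) (P0 : probability X R) (lam : nat -> R) (phi : nat -> X -> R)
    (n : nat) (Delta : R -> R) (th1 th2 M c : R) (I : finType)
    (P : I -> probability X R) (th : I -> R) :
  (0 < #|I|)%N ->
  (forall i, th1 <= th i <= th2) ->
  (forall i, Pclass P0 lam phi (Delta (th i)) (th i) M (P i)) ->
  (forall T : n.-tuple X -> R, tests T ->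
    (c%:E <= iidE P0 (fun t => (T t)%:E) +
     \sum_i (#|I|%:R^-1)%:E * iidE (P i) (fun t => (1 - T t)%:E))%E) ->
  (c%:E <= minimax_risk P0 lam phi n Delta th1 th2 M)%E.
Proof.
move=> I0 hth hP hc; apply: le_ereal_inf_tmp => _ [T hT <-].
apply: le_trans (hc T hT) _; apply: leeD2l; apply: ge_weighted_sume => // i.
  apply: iidE_ge0 => t; case: hT => _ /(_ t) /andP[_ T1].
  by rewrite lee_fin subr_ge0.
apply: le_trans; last first.
  by apply: ereal_sup_ubound; exists (th i) => //=; exact: hth.
by apply: ereal_sup_ubound; exists (P i).
Qed.

Section random_sign_prior.
Context (d : measure_display) (X : measurableType d) (R : realType).
Variables (P0 : probability X R) (phi psi : nat -> X -> R) (lam : nat -> R).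
Hypothesis mphi : forall k, measurable_fun setT (phi k).
Hypothesis phi_psi : forall k, ae_eq P0 setT (phi k) (psi k).
Hypothesis phi_mean : forall k, Rintegral P0 setT (phi k) = 0.
Hypothesis phi_on : forall j k, L2inner P0 (phi j) (phi k) = (j == k)%:R.
Hypothesis mpsi : forall k, measurable_fun setT (psi k).
Variable B0 : R.
Hypothesis psiB : forall k x, `|psi k x| <= B0.
Hypothesis lam_gt0 : forall k, 0 < lam k.

Variables (n m K : nat) (S : 'I_m -> 'I_K -> bool) (N : 'I_m -> nat).
Variables (a Lam th : 'I_m -> R) (Delta : R -> R) (th1 th2 M E : R).
Hypothesis m_gt0 : (0 < m)%N.
Hypothesis S_disj : forall i j k, S i k -> S j k -> i = j.
Hypothesis card_S : forall j, #|S j| = N j.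
Hypothesis N_gt0 : forall j, (0 < N j)%N.
Hypothesis a_gt0 : forall j, 0 < a j.
Hypothesis Lam_gt0 : forall j, 0 < Lam j.
Hypothesis th1_gt0 : 0 < th1.
Hypothesis th_itv : forall j, th1 <= th j <= th2.
Hypothesis a_small : forall j, a j * (N j)%:R * B0 <= 1.
Hypothesis Delta_le : forall j, Delta (th j) <= a j ^+ 2 * (N j)%:R.
Hypothesis lam_le : forall j k, S j k -> (lam k)^-1 <= Lam j.
Hypothesis smooth : forall j,
  Num.sqrt (a j ^+ 2 * (N j)%:R) *
  Num.sqrt (a j ^+ 2 * (N j)%:R * Lam j) `^ ((th j)^-1) <= M.
Hypothesis E_ge : forall j, expR (2 * (n%:R * a j ^+ 2) ^+ 2 * (N j)%:R) <= E.

(** Signs are indexed by all of ['I_K] and not by one block, which keeps the index a product type;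
    each density of a block is then repeated equally often. *)
Let I : finType := ('I_m * {ffun 'I_K -> bool})%type.

Let b (i : I) (k : nat) : R :=
  if insub k is Some k' then if S i.1 k' then a i.1 * (-1) ^+ i.2 k' else 0 else 0.

Let bE i (k : 'I_K) : b i k = if S i.1 k then a i.1 * (-1) ^+ i.2 k else 0.
Proof. by rewrite /b valK. Qed.

Let f i x := 1 + comb psi K (b i) x.

Let bpsi k : bounded_mfun (psi k). Proof. by split => //; exists B0. Qed.

Let sumS j (c : R) : \sum_(k < K | S j k) c = c * (N j)%:R.
Proof. by rewrite sumr_const -card_S mulr_natr. Qed.

Let f_ge0 i x : 0 <= f i x.
Proof.
suff : `|comb psi K (b i) x| <= 1 by rewrite /f ler_norml => /andP[]; lra.
apply: le_trans (ler_norm_sum _ _ _) _; apply: le_trans (a_small i.1).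
rewrite mulrAC -sumS [leRHS]big_mkcond; apply: ler_sum => k _.
rewrite normrM bE; case: ifP => _; last by rewrite normr0 mul0r.
by rewrite normrM normrX normrN1 expr1n mulr1 (gtr0_norm (a_gt0 _)) ler_pM2l.
Qed.

Let mf i : measurable_fun setT (f i).
Proof. by apply: measurable_funD => //; case: (bounded_comb bpsi K (b i)). Qed.

Let g i i' := 1 + \sum_(k < K) b i k * b i' k.

Let fg i i' : (\int[P0]_x (f i x * f i' x)%:E = (g i i')%:E)%E.
Proof. exact: integral_1Dcomb_1Dcomb. Qed.

(** Being an integral of a product of densities, [g] provides the nonnegativity that
    [sum_sign_moment_le] asks for. *)
Let g_ge0 i i' : 0 <= g i i'.
Proof.
by rewrite -lee_fin -fg; apply: integral_ge0 => x _; rewrite lee_fin mulr_ge0.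
Qed.

Let g_diff i i' : i.1 != i'.1 -> g i i' = 1.
Proof.
move=> ii'; rewrite /g big1 ?addr0// => k _; rewrite !bE.
case: ifP => h1; last by rewrite mul0r.
case: ifP => h2; last by rewrite mulr0.
by move: ii'; rewrite (S_disj h1 h2) eqxx.
Qed.

Let g_same j e e' : g (j, e) (j, e') =
  1 + a j ^+ 2 * \sum_(k | S j k) (-1) ^+ e k * (-1) ^+ e' k.
Proof.
rewrite /g mulr_sumr [in RHS]big_mkcond; congr (_ + _); apply: eq_bigr => k _.
by rewrite !bE /=; case: ifP => _; rewrite ?mul0r// mulrACA expr2.
Qed.

Let E_ge0 : 0 <= E. Proof. exact: le_trans (expR_ge0 _) (E_ge (Ordinal m_gt0)). Qed.

(** On the diagonal the signs of a block are averaged by [sum_sign_moment_le]; off it every term is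
    1, because distinct blocks have disjoint supports. *)
Let block_sum j j' :
  \sum_e \sum_e' g (j, e) (j', e') ^+ n <= 2 ^+ K * 2 ^+ K * (1 + (j == j')%:R * E).
Proof.
have [<-|jj'] := eqVneq j j'.
  apply: le_trans (_ : _ <= 2 ^+ K * 2 ^+ K *
      expR (2 * (n%:R * a j ^+ 2) ^+ 2 * #|S j|%:R)) _.
    under eq_bigr do under eq_bigr do rewrite g_same.
    by apply: sum_sign_moment_le => e e'; rewrite -g_same.
  rewrite ler_pM2l ?mulr_gt0 ?exprn_gt0// card_S mul1r.
  by apply: le_trans (E_ge j) _; rewrite lerDr.
under eq_bigr do under eq_bigr do rewrite g_diff// expr1n.
rewrite mul0r addr0 mulr1 !sumr_const card_ffun card_ord card_bool.
by rewrite -mulrnA natrM natrX.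
Qed.

(** Only the [m] diagonal pairs among the [m ^ 2] pairs of blocks contribute the extra [E], whence
    [(m ^ 2 + m E) / m ^ 2 = 1 + E / m]. *)
Let second_moment :
  #|I|%:R^-1 ^+ 2 * (\sum_i \sum_i' g i i' ^+ n) - 1 <= E / m%:R.
Proof.
have m0 : m%:R != 0 :> R by rewrite pnatr_eq0 -lt0n.
have K0 : 2 ^+ K != 0 :> R by rewrite expf_neq0.
have -> : #|I|%:R = m%:R * 2 ^+ K :> R.
  by rewrite card_prod card_ffun !card_ord card_bool natrM natrX.
rewrite lerBlDl.
have -> : 1 + E / m%:R =
    (m%:R * 2 ^+ K)^-1 ^+ 2 * (2 ^+ K * 2 ^+ K * (m%:R * (m%:R + E))) :> R.
  by field; rewrite m0 K0.
apply: ler_wpM2l; first exact: sqr_ge0.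
rewrite -(pair_bigA _ (fun j e => \sum_i' g (j, e) i' ^+ n)) /=.
apply: (@le_trans _ _ (\sum_(j < m) \sum_(j' < m)
    2 ^+ K * 2 ^+ K * (1 + (j == j')%:R * E))).
  apply: ler_sum => j _; apply: le_trans (_ : _ <=
      \sum_(j' < m) \sum_e \sum_e' g (j, e) (j', e') ^+ n) _; last first.
    by apply: ler_sum => j' _; exact: block_sum.
  rewrite [leRHS]exchange_big /=; apply: ler_sum => e _.
  by rewrite -(pair_bigA _ (fun j' e' => g (j, e) (j', e') ^+ n)).
have -> : 2 ^+ K * 2 ^+ K * (m%:R * (m%:R + E)) =
    \sum_(j < m) 2 ^+ K * 2 ^+ K * (m%:R + E) :> R.
  by rewrite sumr_const card_ord -[RHS]mulr_natl mulrCA.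
apply: ler_sum => j _; rewrite -mulr_sumr; apply: ler_wpM2l.
  by rewrite mulr_ge0// exprn_ge0.
rewrite big_split /= sumr_const card_ord lerD2l -mulr_suml.
by rewrite (bigD1 j)//= eqxx big1 ?addr0 ?mul1r// => j' /negbTE; rewrite eq_sym => ->.
Qed.

Lemma random_sign_minimax_risk_ge (eta : R) : 0 < eta ->
  ((1 - E / m%:R / (2 * eta) - eta / 2)%:E <=
   minimax_risk P0 lam phi n Delta th1 th2 M)%E.
Proof.
move=> eta0.
have I0 : (0 < #|I|)%N.
  by apply/card_gt0P; exists (Ordinal m_gt0, [ffun=> true]).
have /choice[P PE] (i : I) : exists P : probability X R,
    forall A, measurable A -> P A = (\int[P0]_(x in A) (f i x)%:E)%E.
  by apply: exists_probability_density => //; exact: integral_1Dcomb.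
apply: (average_le_minimax_risk (P := P) (th := fun i => th i.1)) => //.
  move=> [j e] /=; have aN : 0 < a j ^+ 2 * (N j)%:R.
    by rewrite mulr_gt0 ?exprn_gt0 ?ltr0n.
  have bsum : \sum_(k < K) b (j, e) k ^+ 2 = a j ^+ 2 * (N j)%:R.
    rewrite -sumS [RHS]big_mkcond; apply: eq_bigr => k _.
    by rewrite bE /=; case: ifP => _; rewrite ?expr0n// exprMn sqrr_sign mulr1.
  have /andP[t1 _] := th_itv j.
  (* The witness [W] is the squared norm [a j ^+ 2 * (N j)%:R] times [Lam j], the bound on the
     inverse eigenvalues over the block. *)
  apply: (@comb_Pclass _ _ _ P0 phi psi _ _ _ _ _ lam lam_gt0 K (b (j, e))
    (a j ^+ 2 * (N j)%:R * Lam j)) => //.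
  - exact: lt_le_trans th1_gt0 t1.
  - by rewrite mulr_gt0.
  - rewrite mulrAC -sumS [leRHS]big_mkcond; apply: ler_sum => k _.
    rewrite bE /=; case: ifP => Sk; last by rewrite expr0n mulr0.
    by rewrite exprMn sqrr_sign mulr1 mulrC ler_pM2l ?exprn_gt0// lam_le.
  - by rewrite bsum.
  - by rewrite bsum.
  - exact: PE.
move=> T hT; apply: le_trans (test_risk_ge I0 mf f_ge0 PE fg hT eta0).
rewrite lee_fin lerB// lerD2l lerN2 ler_pM2r ?invr_gt0 ?mulr_gt0//.
Qed.

End random_sign_prior.

(** * Dyadic blocks and rate exponents *)

(** Position [k] holds the eigenpair of rank [k.+1], so the block starts at position [2 ^ J - 1]. *)
Lemma card_dyadic_block (J K : nat) : (2 ^ J.+1 <= K)%N ->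
  #|(fun k : 'I_K => 2 ^ J <= k.+1 < 2 ^ J.+1)%N| = (2 ^ J)%N.
Proof.
move=> JK; have J0 : (0 < 2 ^ J)%N by rewrite expn_gt0.
have JS : (2 ^ J.+1 = 2 ^ J + 2 ^ J)%N by rewrite expnS mul2n addnn.
rewrite -sum1_card.
rewrite -(big_mkord (fun k => 2 ^ J <= k.+1 < 2 ^ J.+1)%N (fun=> 1%N)).
transitivity (\sum_((2 ^ J).-1 <= k < (2 ^ J.+1).-1) 1)%N; last first.
  by rewrite sum_nat_const_nat muln1; lia.
rewrite [RHS](@big_nat_widen _ _ _ _ _ K); last by lia.
rewrite [RHS](@big_nat_widenl _ _ _ _ 0%N)//.
by apply: eq_bigl => k; apply/idP/idP => /andP[]; lia.
Qed.

Definition rate_exponent (R : realType) (s th : R) : R :=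
  2 * (th + 1) / (4 * s + th + 1).

(** This is the inverse of [rate_exponent s]: it solves [e (4 s + th + 1) = 2 (th + 1)] for [th]. *)
Definition rate_smoothness (R : realType) (s e : R) : R :=
  4 * s * e / (2 - e) - 1.

Lemma rate_exponent_lt (R : realType) (s th th' : R) :
  1 / 2 < s -> 0 < th -> th < th' -> rate_exponent s th < rate_exponent s th'.
Proof.
move=> s0 th0 thth'; rewrite /rate_exponent.
have p1 : 0 < 4 * s + th + 1 by lra.
have p2 : 0 < 4 * s + th' + 1 by lra.
by rewrite ltr_pdivrMr// mulrAC ltr_pdivlMr//; nra.
Qed.

(** The value [2 / 3] is attained exactly at [th = 2 s - 1]. *)
Lemma rate_exponent_lt23 (R : realType) (s th : R) :
  0 < th -> th < 2 * s - 1 -> rate_exponent s th < 2 / 3.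
Proof.
move=> th0 ths; rewrite /rate_exponent ltr_pdivrMr; first lra.
by lra.
Qed.

Lemma rate_exponent_gt0 (R : realType) (s th : R) :
  1 / 2 < s -> 0 < th -> 0 < rate_exponent s th.
Proof. by move=> s0 th0; rewrite /rate_exponent divr_gt0//; lra. Qed.

Lemma rate_smoothness_itv (R : realType) (s th1 th2 e : R) :
  1 / 2 < s -> 0 < th1 -> th1 < th2 -> th2 < 2 * s - 1 ->
  rate_exponent s th1 <= e <= rate_exponent s th2 ->
  th1 <= rate_smoothness s e <= th2.
Proof.
move=> s0 th10 th12 ths /andP[e1 e2].
have h23 : rate_exponent s th2 < 2 / 3 by apply: rate_exponent_lt23 => //; lra.
have p1 : 0 < 4 * s + th1 + 1 by lra.
have p2 : 0 < 4 * s + th2 + 1 by lra.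
have pe : 0 < 2 - e by lra.
move: e1 e2; rewrite /rate_exponent ler_pdivrMr// ler_pdivlMr// => e1 e2.
rewrite /rate_smoothness lerBrDr lerBlDr ler_pdivlMr// ler_pdivrMr//.
by apply/andP; split; lra.
Qed.

(** The finitely many terms before [n] are absorbed into the minimum one by one. *)
Lemma positive_seq_bounded_below (R : realType) (u : nat -> R) (l : R) (n : nat) :
  0 < l -> (forall k, 0 < u k) -> (forall k, (n <= k)%N -> l <= u k) ->
  exists2 l', 0 < l' & forall k, l' <= u k.
Proof.
move=> + u0; elim: n l => [|n IH] l l0 h.
  by exists l => // k; exact: h.
apply: (IH (Num.min l (u n))); first by rewrite lt_min l0 u0.
move=> k; rewrite leq_eqVlt => /predU1P[<-|nk]; first by rewrite ge_min lexx orbT.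
by rewrite ge_min h.
Qed.

Lemma limn_esup_lt_near (R : realType) (u : nat -> \bar R) (c : \bar R) :
  (limn_esup u < c)%E -> \forall n \near \oo, (u n <= c)%E.
Proof.
move=> /ereal_inf_lt[_ [V Voo <-] Vc]; apply: filterS Voo => n Vn.
by apply: le_trans (ltW Vc); apply: ereal_sup_ubound; exists n.
Qed.

Lemma limn_einf_gt_near (R : realType) (u : nat -> \bar R) (c : \bar R) :
  (c < limn_einf u)%E -> \forall n \near \oo, (c <= u n)%E.
Proof.
rewrite /limn_einf lteNr => /limn_esup_lt_near; apply: filterS => n /=.
by rewrite leeN2.
Qed.

Lemma limn_einf_gt0_bounded_below (R : realType) (u : nat -> R) :
  (forall k, 0 < u k) -> (0 < limn_einf (fun k => (u k)%:E))%E ->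
  exists2 l, 0 < l & forall k, l <= u k.
Proof.
move=> u0 hu.
have [l l0 lu] : exists2 l : R, 0 < l & (l%:E < limn_einf (fun k => (u k)%:E))%E.
  (* The lower limit may be infinite, in which case any positive [l] serves. *)
  case: limn_einf hu => [r| |]; [|by exists 1; rewrite ?ltry|by []].
  by rewrite lte_fin => r0; exists (r / 2); rewrite ?lte_fin; lra.
have [n _ hn] := limn_einf_gt_near lu.
by apply: (positive_seq_bounded_below (n := n) l0 u0) => k /hn; rewrite lee_fin.
Qed.

(** The test that never rejects has type I error 0 and type II error at most 1. *)
Lemma minimax_risk_le1 (d : measure_display) (X : measurableType d)
    (R : realType) (P0 : probability X R) (lam : nat -> R) (phi : nat -> X -> R)
    (n : nat) (Delta : R -> R) (th1 th2 M : R) :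
  (minimax_risk P0 lam phi n Delta th1 th2 M <= 1)%E.
Proof.
apply: (@le_trans _ _ (iidE P0 (fun _ : n.-tuple X => 0%:E) +
   ereal_sup [set typeII P0 lam phi (fun _ : n.-tuple X => 0%R) (Delta th) th M
             | th in [set th : R | (th1 <= th <= th2)%R]])%E).
  apply: ereal_inf_lbound; exists (fun=> 0) => //.
  by split; [exact: measurable_cst|move=> t; rewrite lexx ler01].
rewrite iidE_cst// add0e; apply: ge_ereal_sup => _ [th _ <-].
apply: ge_ereal_sup => _ [P _ <-].
by under eq_iidE do rewrite subr0; rewrite iidE_cst.
Qed.

Lemma sqrt_expR (R : realType) (x : R) : Num.sqrt (expR x) = expR (x / 2).
Proof. by rewrite -powR12_sqrt ?expR_ge0// -expRM. Qed.

(* With N = expR (e * T) and t = expR T, the squared L2 norm of the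
   perturbations is c * sqrt N / t = expR (C + (e / 2 - 1) * T). *)
Lemma dyadic_smooth (R : realType) (s e T C D M th : R) :
  th = rate_smoothness s e -> 0 < th -> e < 2 -> 0 < M ->
  (th + 1) * C + D <= 2 * th * ln M ->
  Num.sqrt (expR (C + (e / 2 - 1) * T)) *
  Num.sqrt (expR (C + (e / 2 - 1) * T) * expR (D + 2 * s * e * T)) `^ th^-1 <= M.
Proof.
move=> thE th0 e2 M0 h.
have e2' : 2 - e != 0 by rewrite gt_eqF// subr_gt0.
rewrite -expRD !sqrt_expR -expRM -expRD -[leRHS]lnK ?posrE// ler_expR.
rewrite -(ler_pM2l (_ : 0 < 2 * th)) ?mulr_gt0//.
apply: le_trans h; rewrite le_eqVlt; apply/orP; left; apply/eqP.
(* The coefficient of [T] vanishes because [th] is the smoothness matched with [e]; what remains is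
   a bound uniform in [T]. *)
have key : (th + 1) * (e / 2 - 1) + 2 * s * e = 0.
  by rewrite thE /rate_smoothness; field.
transitivity ((th + 1) * C + D + ((th + 1) * (e / 2 - 1) + 2 * s * e) * T).
  by field; rewrite gt_eqF.
by rewrite key mul0r addr0.
Qed.

(** * Risk bound along a dyadic grid of smoothness levels *)

Section dyadic_prior.
Context (d : measure_display) (X : measurableType d) (R : realType).
Variables (P0 : probability X R) (phi psi : nat -> X -> R) (lam : nat -> R).
Hypothesis mphi : forall k, measurable_fun setT (phi k).
Hypothesis phi_psi : forall k, ae_eq P0 setT (phi k) (psi k).
Hypothesis phi_mean : forall k, Rintegral P0 setT (phi k) = 0.
Hypothesis phi_on : forall j k, L2inner P0 (phi j) (phi k) = (j == k)%:R.
Hypothesis mpsi : forall k, measurable_fun setT (psi k).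
Variable B0 : R.
Hypothesis B0_ge0 : 0 <= B0.
Hypothesis psiB : forall k x, `|psi k x| <= B0.
Hypothesis lam_gt0 : forall k, 0 < lam k.
Variables (s th1 th2 M C D : R).
Hypothesis s_gt : 1 / 2 < s.
Hypothesis th1_gt0 : 0 < th1.
Hypothesis th12 : th1 < th2.
Hypothesis th2_lt : th2 < 2 * s - 1.
Hypothesis M_gt0 : 0 < M.
Hypothesis lamD : forall k, (lam k)^-1 <= expR D * k.+1%:R `^ (2 * s).
Hypothesis CD : forall th, th1 <= th <= th2 ->
  (th + 1) * C + (D + 2 * s * ln 2) <= 2 * th * ln M.
Hypothesis expRC_le : expR C <= 1 / 2.

Let e1 := rate_exponent s th1.
Let e2 := rate_exponent s th2.

(** [T] stands for [ln t] and [l] for [ln (ln n)], so that powers of [t] become linear exponents.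
    The conditions on [J0] and [m] keep every matched smoothness between [th1] and [th2]. *)
Lemma dyadic_minimax_risk_ge (n m J0 : nat) (T l : R) (Delta : R -> R) (eta : R) :
  0 < T -> (n%:R * expR (- T)) ^+ 2 = l -> (0 < m)%N ->
  e1 * T <= J0%:R * ln 2 -> (J0 + m)%N.-1%:R * ln 2 <= e2 * T ->
  B0 ^+ 2 * expR ((3 / 2 * e2 - 1) * T) <= 1 ->
  (forall th, th1 <= th <= th2 ->
     Delta th * expR T `^ (4 * s / (4 * s + th + 1)) <= expR C) ->
  0 < eta ->
  ((1 - expR (l / 2) / m%:R / (2 * eta) - eta / 2)%:E <=
   minimax_risk P0 lam phi n Delta th1 th2 M)%E.
Proof.
move=> T0 nT m0 hJ0 hJm hB hDelta eta0.
have ln20 : 0 < ln 2 :> R by rewrite ln_gt0// ltr1n.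
have e2_lt : e2 < 2 / 3.
  exact: rate_exponent_lt23 (lt_trans th1_gt0 th12) th2_lt.
pose N (j : 'I_m) := (2 ^ (J0 + j))%N.
pose e (j : 'I_m) : R := (J0 + j)%:R * ln 2 / T.
have eT j : e j * T = (J0 + j)%:R * ln 2 by rewrite /e divfK// gt_eqF.
have NE j : (N j)%:R = expR (e j * T) :> R.
  by rewrite eT expRM_natl lnK ?posrE// /N natrX.
have e_itv j : e1 <= e j <= e2.
  apply/andP; split; rewrite -(ler_pM2r T0) eT.
    by apply: le_trans hJ0 _; rewrite ler_pM2r// ler_nat leq_addr.
  apply: le_trans hJm; rewrite ler_pM2r// ler_nat.
  by have := ltn_ord j; lia.
have e_lt j : e j < 2.
  by have /andP[_ ej] := e_itv j; apply: le_lt_trans ej _; lra.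
pose th j := rate_smoothness s (e j).
have th_itv j : th1 <= th j <= th2 by exact: rate_smoothness_itv.
have th_gt0 j : 0 < th j by have /andP[t1 _] := th_itv j; exact: lt_le_trans t1.
(* The amplitude is chosen so that [a j ^+ 2 * N j] equals [expR C] times the critical radius
   [sqrt (N j) / t]. *)
pose a j : R := expR ((C - (e j / 2 + 1) * T) / 2).
have a2E j : a j ^+ 2 = expR (C - (e j / 2 + 1) * T).
  by rewrite -expRM_natl; congr expR; field.
have a2N j : a j ^+ 2 * (N j)%:R = expR (C + (e j / 2 - 1) * T).
  by rewrite a2E NE -expRD; congr expR; field.
pose S (j : 'I_m) (k : 'I_(2 ^ (J0 + m))) := (2 ^ (J0 + j) <= k.+1 < 2 ^ (J0 + j).+1)%N.
pose Lam j : R := expR (D + 2 * s * ln 2 + 2 * s * e j * T).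
apply: (@random_sign_minimax_risk_ge _ _ _ P0 phi psi lam mphi phi_psi phi_mean
  phi_on mpsi B0 psiB lam_gt0 n m (2 ^ (J0 + m)) S N a Lam th) => //.
- move=> i j k Si Sj; apply/val_inj/(@addnI J0).
  (* The exponent of the block is recovered as the integer base-2 logarithm of [k.+1]. *)
  by rewrite -(trunc_log_eq (ltnSn 1) Si) -(trunc_log_eq (ltnSn 1) Sj).
- move=> j; apply: card_dyadic_block; rewrite leq_exp2l// -addnS leq_add2l.
  exact: ltn_ord.
- by move=> j; rewrite expn_gt0.
- by move=> j; exact: expR_gt0.
- by move=> j; exact: expR_gt0.
- move=> j; rewrite -(@ler_pXn2r _ 2) ?nnegrE ?mulr_ge0 ?expR_ge0//.
  rewrite expr1n; apply: le_trans hB; rewrite mulrC exprMn.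
  apply: ler_wpM2l; first exact: sqr_ge0.
  (* The exponent [3 / 2 * e j - 1] increases with [e j], so the assumption at [e2] covers all
     blocks. *)
  have -> : (a j * (N j)%:R) ^+ 2 = expR C * expR ((3 / 2 * e j - 1) * T).
    by rewrite exprMn a2E NE -expRM_natl -!expRD; congr expR; field.
  apply: (@le_trans _ _ (1 * expR ((3 / 2 * e j - 1) * T))).
    by rewrite ler_pM2r ?expR_gt0//; move: expRC_le; lra.
  rewrite mul1r ler_expR ler_pM2r//.
  by have /andP[_ ej] := e_itv j; lra.
- move=> j; rewrite a2N.
  have := hDelta _ (th_itv j).
  (* With this identity the assumption on [Delta] says exactly that it is at most
     [expR C * t ^ (e j / 2 - 1)]. *)
  have -> : 4 * s / (4 * s + th j + 1) = 1 - e j / 2.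
    rewrite /th /rate_smoothness; field.
    by rewrite gt_eqF ?subr_gt0//= gt_eqF//; move: s_gt; lra.
  rewrite -expRM -ler_pdivlMr ?expR_gt0// -expRN -expRD => /le_trans; apply.
  by rewrite ler_expR; lra.
- move=> j k /andP[_ kJ]; apply: le_trans (lamD k) _.
  rewrite /Lam -addrA expRD ler_pM2l ?expR_gt0//.
  (* Inside the block [k.+1 <= 2 * N j]; this factor 2 is the source of [2 * s * ln 2] in [Lam] and
     [CD]. *)
  have -> : 2 * s * ln 2 + 2 * s * e j * T = (ln 2 + e j * T) * (2 * s) by ring.
  rewrite expRM; apply: ge0_ler_powR; rewrite ?nnegrE ?expR_ge0//.
    by move: s_gt; lra.
  by rewrite expRD -NE lnK ?posrE// -natrM ler_nat /N -expnS ltnW.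
- move=> j; rewrite a2N.
  by apply: dyadic_smooth => //; exact: CD.
- move=> j; rewrite ler_expR.
  (* The block size cancels: the exponent is the same for all blocks, and [expR C <= 1 / 2] brings
     it below [l / 2]. *)
  have -> : 2 * (n%:R * a j ^+ 2) ^+ 2 * (N j)%:R = 2 * expR C ^+ 2 * l.
    rewrite -nT NE a2E.
    have x : expR (C - (e j / 2 + 1) * T) ^+ 2 * expR (e j * T) =
        expR C ^+ 2 * expR (- T) ^+ 2.
      by rewrite -!expRM_natl -!expRD; congr expR; field.
    transitivity (2 * n%:R ^+ 2 *
        (expR (C - (e j / 2 + 1) * T) ^+ 2 * expR (e j * T))); first by ring.
    by rewrite x; ring.
  have l0 : 0 <= l by rewrite -nT sqr_ge0.
  have := expR_ge0 C; have : expR C ^+ 2 <= 1 / 4.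
    by have := expR_ge0 C; move: expRC_le; nra.
  nra.
Qed.

End dyadic_prior.

(** * Growth of the number of blocks with the sample size *)

(** With [y = ln n], the number of blocks is of order [y] while the second moment within a block is
    at most [sqrt y]; their ratio is of order [1 / sqrt y] and falls below [eps ^+ 2]. *)
Lemma grid_size_asymptotics (R : realType) (e1 e2 B eps : R) :
  0 < e1 -> e1 < e2 -> e2 < 2 / 3 -> 0 < eps ->
  exists Y : R, forall n : nat, Y <= ln n%:R ->
    let T := ln (n%:R / Num.sqrt (ln (ln n%:R))) in
    [/\ 0 < T, expR T = n%:R / Num.sqrt (ln (ln n%:R)),
        (n%:R * expR (- T)) ^+ 2 = ln (ln n%:R),
        B ^+ 2 * expR ((3 / 2 * e2 - 1) * T) <= 1 &
        exists m J : nat, [/\ (0 < m)%N, e1 * T <= J%:R * ln 2,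
          (J + m)%N.-1%:R * ln 2 <= e2 * T &
          expR (ln (ln n%:R) / 2) / m%:R <= eps ^+ 2]].
Proof.
move=> e10 e12 e23 eps0.
have ln20 : 0 < ln 2 :> R by rewrite ln_gt0// ltr1n.
have p32 : 0 < 1 - 3 / 2 * e2 by lra.
pose ka := (e2 - e1) / (2 * ln 2).
have ka0 : 0 < ka by rewrite divr_gt0 ?mulr_gt0// subr_gt0.
(* [ka * Z] exceeds [(eps ^+ 2)^-1 + 1], the last 1 paying for the truncation of [x2] to [m]. *)
pose Z := 1 + ((eps ^+ 2)^-1 + 1) / ka.
have eps20 : 0 < eps ^+ 2 by rewrite exprn_gt0.
have Z1 : 1 <= Z by rewrite lerDl divr_ge0// ?ltW// addr_gt0 ?invr_gt0.
have BY0 : 0 <= 2 * B ^+ 2 / (1 - 3 / 2 * e2).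
  by rewrite divr_ge0 ?(ltW p32)// mulr_ge0// sqr_ge0.
(* The three summands ensure, in order, [ln y > 0], nonnegative densities, and [Z <= sqrt y]. *)
exists (2 + 2 * B ^+ 2 / (1 - 3 / 2 * e2) + Z ^+ 2) => n.
set y := ln n%:R => hY; set l := ln y; rewrite /=.
have Z20 : 0 <= Z ^+ 2 by exact: sqr_ge0.
have y2 : 2 <= y by lra.
have y0 : 0 < y by lra.
have yZ : Z ^+ 2 <= y by lra.
have n0 : 0 < n%:R :> R.
  (* By convention [ln 0 = 0], so [2 <= y] excludes [n = 0]. *)
  rewrite ltr0n lt0n; apply/eqP => n0.
  by move: y2; rewrite /y n0 ln0//; lra.
have l0 : 0 < l by rewrite ln_gt0//; lra.
have ly : l < y by exact: ln_sublinear.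
have lnl : ln l < l by exact: ln_sublinear.
have sl0 : 0 < Num.sqrt l by rewrite sqrtr_gt0.
set T := ln _.
have ET : expR T = n%:R / Num.sqrt l by rewrite lnK// posrE divr_gt0.
have TE : T = y - ln l / 2.
  rewrite /T ln_div ?posrE// -/y; congr (_ - _).
  by rewrite -powR12_sqrt ?ltW// ln_powR mulrC.
(* This uses [ln l < l < y]. *)
have Ty : y / 2 <= T by lra.
have T0 : 0 < T by lra.
split=> //.
- by rewrite expRN ET invf_div mulrC divfK ?gt_eqF// sqr_sqrtr// ltW.
- apply: (@le_trans _ _ (expR (B ^+ 2) * expR ((3 / 2 * e2 - 1) * T))).
    rewrite ler_pM2r ?expR_gt0//.
    by apply: le_trans (expR_ge1Dx _); rewrite lerDr.
  rewrite -expRD expR_le1.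
  have : 2 * B ^+ 2 / (1 - 3 / 2 * e2) <= 2 * T by lra.
  by rewrite ler_pdivrMr//; lra.
pose x1 := e1 * T / ln 2; pose x2 := (e2 - e1) * T / ln 2.
have x10 : 0 <= x1 by rewrite divr_ge0 ?ltW// mulr_gt0.
have x20 : 0 <= x2 by rewrite divr_ge0 ?ltW// mulr_gt0// subr_gt0.
have /andP[t1 t1'] := truncn_itv x10.
have /andP[t2 t2'] := truncn_itv x20.
set m := Num.trunc x2 in t2 t2'; set J := Num.trunc x1 in t1 t1'.
have z0 : 0 <= Num.sqrt y by rewrite sqrtr_ge0.
have zz : Num.sqrt y ^+ 2 = y by rewrite sqr_sqrtr// ltW.
have zZ : Z <= Num.sqrt y.
  by rewrite -(@ler_pXn2r _ 2) ?nnegrE ?zz//; lra.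
have x2y : ka * y <= x2.
  rewrite (_ : x2 = ka * (2 * T)); last by rewrite /ka /x2; field; rewrite gt_eqF.
  by rewrite ler_pM2l//; lra.
have kz : (eps ^+ 2)^-1 + 1 <= ka * Num.sqrt y.
  rewrite -ler_pdivrMl// mulrC; apply: le_trans zZ; rewrite /Z; lra.
have zm : Num.sqrt y <= eps ^+ 2 * m%:R.
  have h1 : ((eps ^+ 2)^-1 + 1) * Num.sqrt y <= m%:R + 1.
    apply: (@le_trans _ _ (ka * Num.sqrt y * Num.sqrt y)); first exact: ler_wpM2r.
    rewrite -mulrA -expr2 zz; apply: le_trans x2y _.
    by rewrite natr1 ltW.
  rewrite -ler_pdivrMl//; lra.
have m0 : (0 < m)%N.
  rewrite lt0n; apply/eqP => m0.
  by move: zm; rewrite m0 mulr0; lra.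
(* The start is [x1] rounded up and the count is [x2] rounded down; the last block has exponent
   [J + m <= x1 + x2]. *)
exists m, J.+1; split => //.
- by rewrite -ler_pdivrMr// -/x1 ltW.
- rewrite addSn /= natrD -ler_pdivlMr//.
  have -> : e2 * T / ln 2 = x1 + x2 by rewrite /x1 /x2; field; rewrite gt_eqF.
  exact: lerD.
- rewrite -sqrt_expR lnK ?posrE// ler_pdivrMr// ?ltr0n//.
Qed.

(** * Passage to the limit *)

Lemma cvge_to1_near (R : realType) (u : nat -> \bar R) :
  (forall n, u n <= 1)%E ->
  (forall eps : R, 0 < eps -> \forall n \near \oo, ((1 - eps)%:E <= u n)%E) ->
  u @ \oo --> 1%:E.
Proof.
move=> u1 hu; apply/fine_cvgP; split.
  (* The choice [eps = 1] makes the sequence eventually nonnegative, hence finite. *)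
  apply: filterS (hu 1 ltr01) => n; rewrite subrr => un0.
  by rewrite ge0_fin_numE// (le_lt_trans (u1 n))// ltry.
apply/cvgrPdist_le => eps eps0; apply: filterS (hu eps eps0) => n /=.
move: (u1 n); case: (u n) => [r| |] //=.
by rewrite !lee_fin => r1 er; rewrite ger0_norm; lra.
Qed.

Theorem theorem6
  (d : measure_display) (X : measurableType d) (R : realType)
  (P0 : probability X R)
  (K : X -> X -> R) (lam : nat -> R) (phi : nat -> X -> R) (s : R)
  (* s > 1/2 *)
  (hs : 1 / 2 < s)
  (* eigenvalues: positive, strictly decreasing (lam k is lambda_{k+1}) *)
  (hlam_pos : forall k, 0 < lam k)
  (hlam_dec : forall k, lam k.+1 < lam k)
  (* 0 < liminf_k k^{2s} lambda_k <= limsup_k k^{2s} lambda_k < oo *)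
  (hlam_inf : (0 < limn_einf (fun k => ((k.+1%:R `^ (2 * s)) * lam k)%:E))%E)
  (hlam_sup : (limn_esup (fun k => ((k.+1%:R `^ (2 * s)) * lam k)%:E) < +oo)%E)
  (* phi_k measurable, P0-mean zero, orthonormal in L_2(P0) *)
  (hphi_meas : forall k, measurable_fun setT (phi k))
  (hphi_mean : forall k, Rintegral P0 setT (phi k) = 0)
  (hphi_on : forall j k, L2inner P0 (phi j) (phi k) = (j == k)%:R)
  (* {phi_k} is total in the P0-mean-zero subspace of L_2(P0) *)
  (hphi_basis : forall f : X -> R, L2fun P0 f -> Rintegral P0 setT f = 0 ->
     forall eps : R, 0 < eps -> exists (N : nat) (a : nat -> R),
       (L2norm P0 (fun x => f x - \sum_(k < N) a k * phi k x)%R < eps%:E)%E)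
  (* sup_k ||phi_k||_oo < oo *)
  (hphi_bdd : exists B : R, forall k, {ae P0, forall x, `|phi k x| <= B})
  (* Mercer decomposition K(x,x') = sum_k lambda_k phi_k(x) phi_k(x') *)
  (hK : {ae P0, forall x, {ae P0, forall x',
          (fun N => \sum_(k < N) lam k * phi k x * phi k x') @ \oo --> K x x'}})
  (M th1 th2 : R)
  (hM : 0 < M) (hth1 : 0 < th1) (hth12 : th1 < th2) (hth2 : th2 < 2 * s - 1) :
  exists c2 : R, 0 < c2 /\
    forall Delta : nat -> R -> R,
      (limn_esup (fun n : nat =>
         ereal_sup [set (Delta n th *
                          (n%:R / Num.sqrt (ln (ln n%:R))) `^ (4 * s / (4 * s + th + 1)))%:E
                   | th in [set th : R | (th1 <= th <= th2)%R]]) <= c2%:E)%E ->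
      (fun n : nat => minimax_risk P0 lam phi n (Delta n) th1 th2 M) @ \oo --> 1%:E.
Proof.
have [B hB] := hphi_bdd.
pose B0 := `|B|.
(* Truncation at [B0] turns the almost sure bound into an everywhere bound and changes [phi k] only
   on a null set. *)
pose psi k x := Num.max (- B0) (Num.min B0 (phi k x)).
have mpsi k : measurable_fun setT (psi k).
  by apply: measurable_maxr => //; exact: measurable_minr.
have psiB k x : `|psi k x| <= B0.
  rewrite ler_norml le_max lexx /= ge_max ge_min lexx /= andbT.
  by have := normr_ge0 B; rewrite /B0; lra.
have phi_psi k : ae_eq P0 setT (phi k) (psi k).
  apply: filterS (hB k) => x hx _.
  have : `|phi k x| <= B0 by apply: le_trans hx _; exact: ler_norm.
  rewrite ler_norml /psi => /andP[h1 h2].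
  by rewrite min_r// max_r.
have u0 k : 0 < k.+1%:R `^ (2 * s) * lam k by rewrite mulr_gt0 ?powR_gt0.
have [ell ell0 hell] := limn_einf_gt0_bounded_below u0 hlam_inf.
pose D := - ln ell.
have lamD k : (lam k)^-1 <= expR D * k.+1%:R `^ (2 * s).
  rewrite /D expRN lnK ?posrE// ler_pdivlMl//.
  by rewrite ler_pdivrMr.
(* The 1 gives [expR C <= 1 / 2]; the other terms absorb the eigenvalue constant and [ln M]
   uniformly over [th <= th2]. *)
pose C := - (1 + `|D + 2 * s * ln 2| + 2 * th2 * `|ln M|).
have C1 : C <= -1.
  by rewrite /C lerN2 -addrA lerDl addr_ge0// mulr_ge0// mulr_ge0//; lra.
have CD th : th1 <= th <= th2 ->
    (th + 1) * C + (D + 2 * s * ln 2) <= 2 * th * ln M.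
  move=> /andP[t1 t2].
  have thM : - (th * ln M) <= th2 * `|ln M|.
    rewrite -mulrN; apply: (@le_trans _ _ (th * `|ln M|)).
      by apply: ler_wpM2l; [lra|rewrite -normrN; exact: ler_norm].
    by apply: ler_wpM2r.
  have thC : (th + 1) * C <= C by nra.
  have := ler_norm (D + 2 * s * ln 2); rewrite {2}/C in thC; lra.
have expC : expR C <= 1 / 2.
  apply: (@le_trans _ _ (expR (- 1))); first by rewrite ler_expR.
  rewrite expRN mul1r lef_pV2 ?posrE ?expR_gt0//.
  by apply: le_trans (expR_ge1Dx 1); lra.
have e1_gt0 := rate_exponent_gt0 hs hth1.
have e12 := rate_exponent_lt hs hth1 hth12.
have e2_lt := rate_exponent_lt23 (lt_trans hth1 hth12) hth2.
have C0 := expR_gt0 C.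
(* Halving leaves strict room, so that the upper limit being at most [c2] forces the supremum below
   [expR C] for all large [n]. *)
exists (expR C / 2); split; first by rewrite divr_gt0.
move=> Delta hDelta; apply: cvge_to1_near => [n|eps eps0].
  exact: minimax_risk_le1.
have [Y hY] := grid_size_asymptotics B0 e1_gt0 e12 e2_lt eps0.
have hD : \forall n \near \oo, (ereal_sup [set (Delta n th *
    (n%:R / Num.sqrt (ln (ln n%:R))) `^ (4 * s / (4 * s + th + 1)))%:E
    | th in [set th : R | (th1 <= th <= th2)%R]] <= (expR C)%:E)%E.
  apply: limn_esup_lt_near; apply: le_lt_trans hDelta _.
  by rewrite lte_fin ltr_pdivrMr//; lra.
near=> n.
have [] := hY n.
  rewrite -[Y]expRK ler_ln ?posrE ?expR_gt0//; last first.
    by rewrite ltr0n; near: n; exists 1%N.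
  near: n; exists (Num.trunc (expR Y)).+1 => // n /= hn.
  by apply: le_trans (ltW (truncnS_gt _)) _; rewrite ler_nat.
set T := ln _ => T0 ET nT hBT [m [J [m0 hJ hJm hm]]].
have B00 : 0 <= B0 by exact: normr_ge0.
apply: le_trans; last first.
  apply: (dyadic_minimax_risk_ge hphi_meas phi_psi hphi_mean hphi_on mpsi B00
    psiB hlam_pos hs hth1 hth12 hth2 hM lamD CD expC T0 nT m0 hJ hJm hBT _ eps0).
  move=> th hth; rewrite ET -lee_fin.
  apply: (@le_trans _ _ _ _ _ _ (near hD n _)) => //.
  by apply: ereal_sup_ubound; exists th.
rewrite lee_fin.
(* The bound is applied with [eta = eps]: the variance term is at most [eps ^+ 2 / (2 * eps)], and
   the total loss is [eps]. *)
have : expR (ln (ln n%:R) / 2) / m%:R / (2 * eps) <= eps / 2.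
  rewrite ler_pdivrMr ?mulr_gt0//.
  by apply: le_trans hm _; rewrite le_eqVlt; apply/orP; left; apply/eqP; field.
lra.
Unshelve. all: by end_near.
Qed.
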